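(* If $\mathfrak h=\omega_1$, then for each countable ordinal $\alpha\ge\omega$ the partial order $\langle\mathbb P(\alpha),\subset\rangle$ is forcing equivalent to $(P(\omega)/\mathrm{Fin})^+$.
   Context: $\mathfrak h$ is the distributivity number of $\langle[\omega]^\omega,\subset^*\rangle$ (the least number of open dense subsets of $(P(\omega)/\mathrm{Fin})^+$ whose intersection is not dense). For an ordinal $\alpha$, $\mathbb P(\alpha)=\{A\subset\alpha:\langle A,\in\rangle\cong\langle\alpha,\in\rangle\}$. $(P(\omega)/\mathrm{Fin})^+$ is the poset of nonzero elements of $P(\omega)$ modulo finite sets. Forcing equivalent means producing the same generic extensions. *)

(* Defs.v *)
From HB Require Import structures.
From mathcomp Require Import all_boot all_order generic_quotient.
From mathcomp Require Import all_classical wochoice.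

Set Implicit Arguments.
Unset Strict Implicit.
Unset Printing Implicit Defensive.

Import Order.TTheory.

Local Open Scope order_scope.
Local Open Scope classical_set_scope.
Local Open Scope quotient_scope.
Local Open Scope card_scope.

Section dense_sets.
Context {d : Order.disp_t} {P : preorderType d}.
Implicit Type D : set P.

(* In forcing posets the smaller element is the stronger condition. *)
Definition open_set D : Prop := forall p q, q <= p -> D p -> D q.

Definition dense_set D : Prop := forall p, exists2 q, q <= p & D q.

End dense_sets.

Section Pow_omega_mod_Fin.

Definition fin_eq (A B : set nat) : bool := `[< finite_set (A `+` B) >].

Lemma fin_eqP A B :
  reflect (finite_set (A `\` B) /\ finite_set (B `\` A)) (fin_eq A B).
Proof. by apply: (equivP (asboolP _)); rewrite finite_setU. Qed.

Lemma finite_setD_trans (A B C : set nat) :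
  finite_set (A `\` B) -> finite_set (B `\` C) -> finite_set (A `\` C).
Proof.
move=> fAB fBC; apply: (@sub_finite_set _ _ ((A `\` B) `|` (B `\` C))).
  move=> n [An nCn]; have [Bn|nBn] := pselect (B n); first by right.
  by left.
by rewrite finite_setU.
Qed.

Lemma fin_eq_refl : reflexive fin_eq.
Proof. by move=> A; apply/fin_eqP; rewrite setDv. Qed.

Lemma fin_eq_sym : symmetric fin_eq.
Proof. by move=> A B; apply/fin_eqP/fin_eqP => -[]. Qed.

Lemma fin_eq_trans : transitive fin_eq.
Proof.
move=> B A C /fin_eqP[fAB fBA] /fin_eqP[fBC fCB].
by apply/fin_eqP; split; [exact: finite_setD_trans fBC|exact: finite_setD_trans fBA].
Qed.

Canonical fin_eq_equiv := EquivRel fin_eq fin_eq_refl fin_eq_sym fin_eq_trans.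

Definition PomegaFin := {eq_quot fin_eq}.

HB.instance Definition _ := Choice.on PomegaFin.
HB.instance Definition _ := Quotient.on PomegaFin.

Lemma PomegaFin_eqP (A B : set nat) :
  reflect (\pi_(PomegaFin) A = \pi_(PomegaFin) B) (fin_eq A B).
Proof. exact: eqmodP. Qed.

Definition PomegaFin_le (x y : PomegaFin) : bool :=
  `[< finite_set (repr x `\` repr y) >].

Lemma PomegaFin_le_pi (A B : set nat) :
  PomegaFin_le (\pi_(PomegaFin) A) (\pi_(PomegaFin) B) <->
  finite_set (A `\` B).
Proof.
have repr_eq (C : set nat) : fin_eq (repr (\pi_(PomegaFin) C)) C.
  by apply/PomegaFin_eqP; rewrite reprK.
have /fin_eqP[fA fA'] := repr_eq A; have /fin_eqP[fB fB'] := repr_eq B.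
split=> [/asboolP fAB|fAB].
  exact: finite_setD_trans fA' (finite_setD_trans fAB fB).
by apply/asboolP/(finite_setD_trans fA)/(finite_setD_trans fAB).
Qed.

Lemma PomegaFin_le_refl : reflexive PomegaFin_le.
Proof. by move=> x; apply/asboolP; rewrite setDv. Qed.

Lemma PomegaFin_le_anti : antisymmetric PomegaFin_le.
Proof.
move=> x y /andP[/asboolP xy /asboolP yx]; rewrite -[x]reprK -[y]reprK.
by apply/PomegaFin_eqP/fin_eqP.
Qed.

Lemma PomegaFin_le_trans : transitive PomegaFin_le.
Proof.
move=> y x z /asboolP xy /asboolP yz.
by apply/asboolP; exact: finite_setD_trans yz.
Qed.

Fact PomegaFin_display : Order.disp_t. Proof. exact: Order.Disp tt tt. Qed.

HB.instance Definition _ := Order.Le_isPOrder.Build PomegaFin_display PomegaFin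
  PomegaFin_le_refl PomegaFin_le_anti PomegaFin_le_trans.

Definition PomegaFin_pos := {x : PomegaFin | x != \pi_(PomegaFin) set0}.

HB.instance Definition _ := SubChoice.on PomegaFin_pos.
HB.instance Definition _ :=
  [SubChoice_isSubPOrder of PomegaFin_pos by <: with PomegaFin_display].

End Pow_omega_mod_Fin.

(* Ordinals are represented by well-ordered types. *)
Section ordinals.

(* An ordinal [a] is at most [b] iff it is isomorphic to an initial segment
   of [b]. *)
Definition ordinal_le d (a : orderType d) d' (b : orderType d') : Prop :=
  exists2 f : a -> b, {mono f : x y / x < y} &
    forall x y, y < f x -> range f y.

(* [W] is an uncountable well-order all of whose initial segments are
   countable. *)
Definition is_omega1 d (W : orderType d) : Prop :=
  [/\ well_order (<=%O : rel W),
      ~ countable [set: W] &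
      forall x : W, countable [set y | y < x]].

Context {d : Order.disp_t}.

(* A is order isomorphic to a; the values of f outside A are irrelevant. *)
Definition is_copy (a : orderType d) (A : set a) : Prop :=
  exists f : a -> a, set_bij A [set: a] f /\ {in A &, {mono f : x y / x < y}}.

Definition copies (a : orderType d) := {A : set a | `[< is_copy A >]}.

HB.instance Definition _ (a : orderType d) := SubChoice.on (copies a).
HB.instance Definition _ (a : orderType d) :=
  [SubChoice_isSubPOrder of copies a by <: with set_display].

End ordinals.

(* The families of open dense subsets of (P(omega)/Fin)^+ whose intersection is
   not dense; the distributivity number h is the least cardinality of such a
   family. *)
Definition non_distributive (F : set (set PomegaFin_pos)) : Prop :=
  (forall D, F D -> open_set D /\ dense_set D) /\
  ~ dense_set (\bigcap_(D in F) D).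

Definition distributivity_number_is (W : Type) : Prop :=
  (exists2 F, non_distributive F & F #= [set: W]) /\
  (forall F, non_distributive F -> [set: W] #<= F).

(* Generic extensions.  The ambient universe plays the role of the ground model
   V.  A sentence of the forcing language of [P] is given by the set of the
   conditions forcing it, and [phi p] reads "p forces phi".  The clause for
   [f_imp phi psi] is correct for conclusions psi forced by p as soon as they are
   forced by densely many conditions below p; [f_imp] is only used with such
   psi. *)
Section forcing_language.
Context {d : Order.disp_t} {P : preorderType d}.
Implicit Types phi psi : set P.

Definition f_and phi psi : set P := phi `&` psi.

Definition f_imp phi psi : set P :=
  [set p | forall r, r <= p -> phi r -> psi r].

Definition f_iff phi psi : set P := f_and (f_imp phi psi) (f_imp psi phi).

(* Quantifiers ranging over the elements of V in [X] *)
Definition f_all (X : Type) (phi : X -> set P) : set P :=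
  [set p | forall x, phi x p].

Definition f_ex (X : Type) (phi : X -> set P) : set P :=
  [set p | forall r, r <= p -> exists2 s, s <= r & exists x, phi x s].

(* Statements about V *)
Definition f_ground (S : Prop) : set P := [set p | S].

(* "t belongs to the canonical generic filter G of P" *)
Definition f_gen (t : P) : set P :=
  [set p | forall r, r <= p -> exists2 s, s <= r & s <= t].

(* A subset of [A : Type] in the generic extension is handled through the family
   of sentences "a belongs to it".  For K such a subset of [B] and a relation
   [sigma] of V between [A] and [B] (a nice name for a subset of [A]),
   [f_val K sigma] is the value sigma[K] = {a | exists b in K, sigma a b}. *)
Definition f_val (A B : Type) (K : B -> set P) (sigma : A -> set B) :
    A -> set P :=
  fun a => f_ex (fun b => f_and (f_ground (sigma a b)) (K b)).

(* "H is a filter on Q meeting every dense subset of Q which is in V" *)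
Definition f_generic d' (Q : preorderType d') (H : Q -> set P) : set P :=
  f_and
    (f_all (fun a => f_all (fun b =>
       f_imp (f_and (f_ground (a <= b)) (H a)) (H b))))
  (f_and
    (f_all (fun a => f_all (fun b =>
       f_imp (f_and (H a) (H b))
             (f_ex (fun c => f_and (f_ground (c <= a /\ c <= b)) (H c))))))
    (f_all (fun D : set Q =>
       f_imp (f_ground (dense_set D))
             (f_ex (fun c => f_and (f_ground (D c)) (H c)))))).

End forcing_language.

(* Every generic extension V[G] by [P] is a generic extension V[H] by [Q].
   As V[G] and V[H] are the least models extending V and containing G, resp. H,
   V[G] = V[H] means that H is in V[G] and G is in V[H], that is, H = sigma[G]
   and G = tau[H] for some names sigma and tau in V.  By the forcing theorem,
   such an H exists in every V[G] iff the conditions forcing this for some given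
   sigma and tau are dense. *)
Definition generic_extensions_sub d (P : preorderType d)
    d' (Q : preorderType d') : Prop :=
  dense_set [set p : P | exists (sigma : Q -> set P) (tau : P -> set Q),
    let H : Q -> set P := f_val f_gen sigma in
    f_and (f_generic H) (f_all (fun t => f_iff (f_gen t) (f_val H tau t))) p].

(* Having the same generic extensions *)
Definition forcing_equivalent d (P : preorderType d)
    d' (Q : preorderType d') : Prop :=
  generic_extensions_sub P Q /\ generic_extensions_sub Q P.

(* Main.v *)
Require Import Defs.
From mathcomp Require Import all_boot all_order generic_quotient.
From mathcomp Require Import all_classical wochoice.

(* A sigma-closed separative poset P with an injection into C = 2^omega and
   omega1 open dense sets without a common element has a dense subset isomorphic
   to the tree of all sequences of elements of C of successor length below omega1
   (the base tree argument).  As the tree depends on omega1 only, any two such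
   posets have the same generic extensions.

   For copies of alpha, sigma-closure is obtained by diagonalising inside each
   block of the Cantor normal form of alpha.  The first block L is cut into an
   omega-sequence of additively indecomposable intervals S_i; sending a copy A to
   the infinite set of the i such that A meets S_i pulls omega1 open dense subsets
   of P(omega)/Fin without a common element back to open dense sets of copies.
   Finally the copies of nat, which are the infinite subsets of nat, are dense in
   (P(omega)/Fin)^+. *)

Set Implicit Arguments.
Unset Strict Implicit.
Unset Printing Implicit Defensive.

Import Order.TTheory.

Local Open Scope order_scope.
Local Open Scope classical_set_scope.
Local Open Scope quotient_scope.
Local Open Scope card_scope.

(** * Well-orders and injective choice *)

(** The obstacle is that 2^omega may exceed omega1, so a tree of height omega1 cannot deal with the
    conditions one per level. Each level instead handles up to 2^omega conditions at once, which
    requires every condition to be compatible with 2^omega members of the antichain of some level;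
    this is where sigma-closure meets the failure of distributivity below every condition. The
    injection into C bounds antichains from above, so every branch gets exactly C-many children and
    the shape of the tree carries no trace of the poset. Sequences of limit length are omitted
    because a branch need not have a greatest lower bound: its children are chosen among all its
    lower bounds. The map from copies to sets of indices only has to transport the failure of
    distributivity; the comparison of the posets goes through the tree. *)

Lemma wf_rec (I T : Type) (lt : I -> I -> Prop) (wf : well_founded lt)
    (F : forall i, (forall j, lt j i -> T) -> T) :
  exists t : I -> T, forall i, t i = F i (fun j _ => t j).
Proof.
exists (Fix wf (fun=> T) F) => i; rewrite Fix_eq // => x f g fg.
by congr (F x _); apply/functional_extensionality_dep => j;
  apply/functional_extensionality_dep => h.
Qed.

Lemma wo_min_rel (T : Type) (R : rel T) (woR : well_order R) (A : set T) :
  A !=set0 -> exists2 m, A m & forall y, A y -> R m y.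
Proof.
move=> [x Ax]; have [|m [[Am lm] _]] := woR [pred x | `[< A x >]].
  by exists x; apply/asboolP.
exists m; first by move: Am => /asboolP.
by move=> y Ay; apply: lm; apply/asboolP.
Qed.

Section well_orders.
Context {d : Order.disp_t} {a : orderType d}.
Context (wo : well_order (<=%O : rel a)).

Lemma wo_min (A : set a) : A !=set0 -> exists2 m, A m & forall y, A y -> m <= y.
Proof. exact: wo_min_rel. Qed.

Lemma wo_wf : well_founded (fun x y : a => x < y).
Proof.
move=> x; apply: contrapT => nx.
have [m nm mmin] := wo_min (A := [set x | ~ Acc (fun x y : a => x < y) x])
  (ex_intro _ x nx).
apply: nm; constructor => y ym; apply: contrapT => /mmin.
by rewrite leNgt ym.
Qed.

End well_orders.

Lemma countable_range (T : Type) (S : set T) : countable S -> S !=set0 ->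
  exists f : nat -> T, range f = S.
Proof.
move=> /pfcard_geP[->[x []]//|[f] _]; exists f.
apply/seteqP; split => [_ [n _ <-]|x Sx]; first exact: funS.
by have [n _ <-] := @surj _ _ _ _ f x Sx; exists n.
Qed.

Lemma bijection_onto (T U : Type) (t0 : T) (A : set U) (f : T -> U) (g : U -> T) :
  injective f -> (forall x, A (f x)) -> {in A &, injective g} ->
  exists h : T -> U, injective h /\ range h = A.
Proof.
move=> finj fA ginj.
have TA : [set: T] #<= A.
  rewrite -(card_le_eql (inj_card_eq (f := f) (A := [set: T]) _)); last first.
    by move=> x y _ _; exact: finj.
  by apply: subset_card_le => _ [x _ <-].
have AT : A #<= [set: T].
  rewrite -(card_le_eql (inj_card_eq ginj)); exact: subset_card_le.
have /card_bijP[h [k hk kh]] := Cantor_Bernstein TA AT.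
pose i (x : T) : [set: T] := SigSub (mem_set I : x \in [set: T]).
exists (fun x => val (h (i x))); split => [x y /val_inj/(can_inj hk)|].
  by move/(congr1 val).
apply/seteqP; split => [_ [x _ <-]|y Ay].
  by have /set_mem := valP (h (i x)).
exists (val (k (SigSub (mem_set Ay)))) => //.
have -> : i (val (k (SigSub (mem_set Ay)))) = k (SigSub (mem_set Ay)).
  exact: val_inj.
by rewrite kh.
Qed.

(* The order type of [R] pulled back along [k] is at most the cardinal of [C], so
   that its proper initial segments are smaller than [C]. *)
Lemma short_well_order (C : eqType) : exists (R : rel C) (k : C -> C),
  [/\ well_order R, injective k & forall x,
  ~ exists g : C -> C, injective g /\ forall y, R (g y) (k x) && (g y != k x)].
Proof.
have [R woR] := well_ordering_principle C.
(* If [C] injects below some point, let [m] be the least such point and [g] the injection. A [g y]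
   with the same property would be a smaller one. *)
pose big x := exists g : C -> C, injective g /\ forall y, R (g y) x && (g y != x).
have [[x bx]|nbig] := pselect (exists x, big x); last first.
  by exists R, id; split=> // x bx; apply: nbig; exists x.
have [m [g [ginj gm]] mmin] := wo_min_rel woR (A := big) (ex_intro _ x bx).
have woch : wo_chain R predT by move=> A _; exact: woR.
exists R, g; split => // y [h [hinj hy]].
have Rmgy : R m (g y) by apply: mmin; exists h.
have /andP[gym /eqP] := gm y; case.
apply: (wo_chain_antisymmetric woch) => //; by rewrite gym.
Qed.

(** Greedy recursion along the order of [short_well_order]: the values taken before [i] are indexed
    by fewer points than [C] has, while [X i] contains an injective image of [C]. *)
Lemma injective_choice (I C : eqType) (T : Type) (t0 : T) (code : I -> C) (J : set I)
    (X : I -> set T) :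
  injective code ->
  (forall i, J i -> exists g : C -> T, injective g /\ forall c, X i (g c)) ->
  exists t : I -> T, (forall i, J i -> X i (t i)) /\ {in J &, injective t}.
Proof.
move=> codeI bigX; have [R [k [woR kI small]]] := short_well_order C.
have woch : wo_chain R predT by move=> A _; exact: woR.
have Rtot : total R by move=> x y; have /(_ x y isT isT) := wo_chainW woch.
pose rk i := k (code i).
have rkI : injective rk by move=> i j /kI/codeI.
pose lt i j := R (rk i) (rk j) && (rk i != rk j).
have wflt : well_founded lt.
  move=> i; apply: contrapT => ni.
  pose B := [set x | exists2 i, x = rk i & ~ Acc lt i].
  have [_ [j -> nj] jmin] := wo_min_rel woR (A := B)
    (ex_intro _ _ (ex_intro2 _ _ i erefl ni)).
  apply: nj; constructor => y /andP[yj /eqP yNj]; apply: contrapT => ny.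
  apply: yNj; apply: (wo_chain_antisymmetric woch) => //.
  by rewrite yj jmin//; exists y.
pose gd i (rec : forall j, lt j i -> T) :=
  [set x | X i x /\ forall j (h : lt j i), J j -> x <> rec j h].
pose F i rec : T := match pselect (exists x, gd i rec x) with
  | left h => sval (cid h) | right _ => t0 end.
have [t tE] := wf_rec wflt F.
have tP i : J i -> gd i (fun j _ => t j) (t i).
  move=> Ji; rewrite [t i]tE /F; case: pselect => [h|]; first exact: (svalP (cid h)).
  case; apply: contrapT => none; have [g [gI gX]] := bigX _ Ji.
  have cov c : exists j, lt j i /\ t j = g c.
    apply: contrapT => nc; apply: none; exists (g c); split => // j h Jj gt.
    by apply: nc; exists j.
  have [s sP] := choice cov.
  apply: (small (code i)); exists (rk \o s); split => [x y /rkI sxy|y].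
    by apply: gI; rewrite -(sP x).2 -(sP y).2 sxy.
  exact: (sP y).1.
exists t; split => [i /tP[]//|i j /set_mem Ji /set_mem Jj tij].
have [//|ij] := eqVneq i j; exfalso.
have rij : rk i != rk j by apply: contra ij => /eqP/rkI->.
case/orP: (Rtot (rk i) (rk j)) => rR.
  by have [_ /(_ i _ Ji)] := tP _ Jj; apply=> //; apply/andP.
by have [_ /(_ j _ Jj)] := tP _ Ji; apply=> //; apply/andP; rewrite eq_sym.
Qed.

(** * The base tree *)

Definition compat (P : Type) (le : P -> P -> Prop) p q := exists2 r, le r p & le r q.

Definition antichain (P : Type) (le : P -> P -> Prop) (A : set P) :=
  forall a b, A a -> A b -> compat le a b -> a = b.

Section refinements.
Context {P : choiceType} (le : P -> P -> Prop).
Context (rle_refl : forall p, le p p).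
Context (rle_trans : forall q p r, le p q -> le q r -> le p r).
Context (rle_sep : forall p q, (forall r, le r p -> compat le r q) -> le p q).
Context (p0 : P).
Context (sigma_closed : forall u : nat -> P,
  (forall n, le (u n.+1) (u n)) -> exists q, forall n, le q (u n)).

Local Notation open O := (forall p q, le q p -> O p -> O q).
Local Notation dense O := (forall p, exists2 q, le q p & O q).
Local Notation C := (nat -> bool).

Lemma compat_sym p q : compat le p q -> compat le q p.
Proof. by case=> r; exists r. Qed.

Lemma compat_le p p' q q' : compat le p q -> le p p' -> le q q' -> compat le p' q'.
Proof.
by move=> [r rp rq] pp' qq'; exists r; [exact: rle_trans pp'|exact: rle_trans qq'].
Qed.

Lemma antichain_extension (A O : set P) : A `<=` O -> antichain le A ->
  exists B, [/\ A `<=` B, B `<=` O, antichain le B &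
    forall q, O q -> exists2 b, B b & compat le b q].
Proof.
(* [Q] constrains the union with [A], so that it also holds of the empty union of an empty chain. *)
move=> AO acA; pose Q B := (A `|` B) `<=` O /\ antichain le (A `|` B).
have [F FQ Ftot|B [[QBO QBa] Bmax]] := @Zorn_bigcup _ Q.
  split=> [x [/AO//|[B FB Bx]]|x y].
    by have [+ _] := FQ _ FB; apply; right.
  move=> [Ax|[B FB Bx]] [Ay|[B' FB' By]].
  - exact: acA.
  - by have [_] := FQ _ FB'; apply; [left|right].
  - by have [_] := FQ _ FB; apply; [right|left].
  - have [BB'|B'B] := Ftot _ _ FB FB'.
      by have [_] := FQ _ FB'; apply; right => //; exact: BB'.
    by have [_] := FQ _ FB; apply; right => //; exact: B'B.
exists (A `|` B); split => // q Oq; apply: contrapT => nq.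
have nqc b : (A `|` B) b -> ~ compat le b q by move=> Bb bq; apply: nq; exists b.
apply: (Bmax (q |` B)).
  split=> [x Bx|qB]; first by right.
  apply: (nqc q); first by right; apply: qB; left.
  by exists q; exact: rle_refl.
split=> [x [Ax|[->//|Bx]]|x y]; [by apply: QBO; left|by apply: QBO; right|].
have red z : (A `|` (q |` B)) z -> z = q \/ (A `|` B) z.
  by move=> [|[]]; [right; left|left|right; right].
move=> /red[->|xB] /red[->|yB] //; first by move=> /compat_sym/nqc.
  by move/nqc.
exact: QBa.
Qed.

Lemma dense_inter (O : nat -> set P) : (forall n, open (O n)) ->
  (forall n, dense (O n)) -> forall p, exists2 q, le q p & forall n, O n q.
Proof.
move=> Oop Ode p.
have /choice[s sP] (np : nat * P) : exists q, le q np.2 /\ O np.1 q.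
  by have [q] := Ode np.1 np.2; exists q.
pose fix u n := if n is m.+1 then s (m, u m) else p.
have [|q qu] := sigma_closed (u := u); first by move=> n; exact: (sP (n, u n)).1.
exists q; first exact: (qu 0).
by move=> n; apply: Oop (qu n.+1) (sP (n, u n)).2.
Qed.

Lemma dense_bigcap (I : Type) (S : set I) (O : I -> set P) : countable S ->
  (forall i, open (O i)) -> (forall i, S i -> dense (O i)) ->
  forall p, exists2 q, le q p & forall i, S i -> O i q.
Proof.
move=> Scount Oop Ode p; have [S0|] := eqVneq S set0.
  by exists p => // i; rewrite S0.
move=> /set0P/(countable_range Scount)[f fS].
have [n|n|q qp qO] := @dense_inter (O \o f) _ _ p.
- exact: Oop.
- by apply: Ode; rewrite -fS; exists n.
by exists q => // i; rewrite -fS => -[n _ <-]; exact: qO.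
Qed.

Lemma chain_lower_bound d (W : orderType d) (S : set W) (u : W -> P) : countable S ->
  (forall i j, S i -> S j -> i <= j -> le (u j) (u i)) ->
  exists q, forall i, S i -> le q (u i).
Proof.
move=> Scount udec; have [S0|] := eqVneq S set0.
  by exists p0 => i; rewrite S0.
move=> /set0P/(countable_range Scount)[f fS].
(* Running maxima turn the enumeration [f] into a nondecreasing sequence cofinal in [S], to which
   sigma-closure applies. *)
pose fix g n := if n is m.+1 then Order.max (g m) (f n) else f 0.
have gS n : g n.+1 = Order.max (g n) (f n.+1) by [].
have Sf n : S (f n) by rewrite -fS; exists n.
have Sg n : S (g n).
  by elim: n => [|n IH]; [exact: Sf|rewrite gS /Order.max; case: ifP].
have gf n : f n <= g n by case: n => [|n] //; rewrite gS le_max lexx orbT.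
have [n|q qu] := sigma_closed (u := u \o g).
  by apply: udec; [exact: Sg|exact: Sg|rewrite gS le_max lexx].
exists q => i; rewrite -fS => -[n _ <-]; apply: rle_trans (qu n) _.
exact: udec.
Qed.

Context {dW : Order.disp_t} {W : orderType dW}.
Context (homega1 : is_omega1 W).

Lemma omega1_bounded (S : set W) : countable S -> exists z, forall x, S x -> x <= z.
Proof.
move=> Sc; apply: contrapT => nb; have [_ unc seg] := homega1; apply: unc.
have -> : [set: W] = \bigcup_(s in S) [set y | y < s].
  apply/seteqP; split => // z _; apply: contrapT => nz; apply: nb; exists z => x Sx.
  by rewrite leNgt; apply/negP => zx; apply: nz; exists x.
exact: bigcup_countable.
Qed.

Lemma countable_initial (x : W) : countable [set y | y <= x].
Proof.
have [_ _ seg] := homega1.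
have -> : [set y | y <= x] = \bigcup_(b in [set: bool])
    (if b then [set y | y < x] else [set x]).
  apply/seteqP; split=> [y /=|y [[] _ /=]]; last by move->.
    by rewrite le_eqVlt => /orP[/eqP->|yx]; [exists false|exists true].
  exact: ltW.
apply: bigcup_countable => // -[] _ //; exact: countable1.
Qed.

Context (code : P -> C) (code_inj : injective code).
Context (D : W -> set P) (Dopen : forall x, open (D x)) (Ddense : forall x, dense (D x)).
Context (Dempty : forall q, exists x, ~ D x q).

Lemma antichain_below (O : set P) : open O -> dense O ->
  exists A, [/\ A `<=` O, antichain le A & forall q, exists2 a, A a & compat le a q].
Proof.
move=> Oop Ode; have [//|//|A [_ AO acA Amax]] := @antichain_extension set0 O.
exists A; split=> // q; have [r rq Or] := Ode q; have [a Aa ar] := Amax _ Or.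
by exists a => //; apply: compat_le ar _ _.
Qed.

(* A binary tree of conditions below [p] splits at countably many levels only, so
   beyond these levels its 2^omega branches are compatible with distinct elements
   of a maximal antichain. *)
Lemma many_compatible : exists B : W -> set P, (forall x, antichain le (B x)) /\
  (forall x q, exists2 b, B x b & compat le b q) /\
  (forall p, exists x, exists beta : C -> P,
    injective beta /\ forall f, B x (beta f) /\ compat le (beta f) p).
Proof.
have /choice[A AP] x := antichain_below (@Dopen x) (@Ddense x).
pose O x q := exists2 a, A x a & le q a.
have Oop x : open (O x).
  by move=> p q qp [a Aa pa]; exists a => //; exact: rle_trans pa.
have Ode x : dense (O x).
  move=> q; have [_ _ /(_ q)[a Aa [r ra rq]]] := AP x.
  by exists r => //; exists a.
have split q : exists w : W * (bool -> P) * (bool -> P), [/\ w.2 true <> w.2 false,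
    forall b, A w.1.1 (w.2 b), forall b, le (w.1.2 b) q &
    forall b, le (w.1.2 b) (w.2 b)].
  (* As [D x] is open and omits [q], [q] is not below [a]. Separativity gives an extension
     incompatible with [a], which is compatible with another member [a'] of [A x]. *)
  have [x nDx] := Dempty q; have [AD acA /[dup] Amax /(_ q)[a Aa aq]] := AP x.
  have [r rq nra] : exists2 r, le r q & ~ compat le r a.
    apply: contrapT => nr; apply: nDx; apply: Dopen (AD _ Aa).
    apply: rle_sep => r rq; apply: contrapT => nra; apply: nr.
    by exists r.
  have [a' Aa' [r' r'a' r'r]] := Amax r; have [s sa sq] := aq.
  exists (x, fun b => if b then s else r', fun b => if b then a else a') => /=.
  split=> [aa'|[]|[]|[]] //; last exact: rle_trans rq.
  by apply: nra; rewrite aa'; exists r'.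
have [w wP] := choice split; pose xi q := (w q).1.1.
pose ch q b := (w q).1.2 b; pose an q b := (w q).2 b.
have [anN Aan chq chan] : [/\ forall q, an q true <> an q false,
    forall q b, A (xi q) (an q b), forall q b, le (ch q b) q &
    forall q b, le (ch q b) (an q b)].
  by split=> q; have [? ? ? ?] := wP q.
pose E x q := forall y, y <= x -> O y q.
have Eop x : open (E x) by move=> p q qp Ep y /Ep; exact: Oop.
have Ede x : dense (E x).
  by move=> p; apply: (dense_bigcap (countable_initial x)).
have /choice[B BP] x := antichain_below (@Eop x) (@Ede x).
exists B; split=> [x|]; first by case: (BP x).
split=> [x q|p]; first by case: (BP x).
(* Histories list the most recent bit first. There are countably many of them, so their levels have
   a common bound [z]. *)
pose fix nd (s : seq bool) := if s is b :: t then ch (nd t) b else p.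
have [|z zP] := @omega1_bounded (range (xi \o nd)).
  by apply: card_le_trans (card_image_le _ _) _; exact: countableP.
pose fix pre (f : C) n := if n is m.+1 then f m :: pre f m else [::].
have /choice[lb lbP] f : exists q, forall n, le q (nd (pre f n)).
  by apply: sigma_closed => n /=; exact: chq.
have /choice[beta betaP] f : exists b, B z b /\ compat le b (lb f).
  by have [_ _ /(_ (lb f))[b]] := BP z; exists b.
exists z, beta; split=> [f g fg|f]; last first.
  have [Bb bl] := betaP f; split=> //; apply: compat_le bl _ _ => //.
  exact: lbP f 0%N.
apply: funext => n.
suff [] : pre f n.+1 = pre g n.+1 by [].
elim: n.+1 => // {}n IH /=; rewrite IH; congr cons.
(* [beta h] lies below exactly one member of the antichain used at this split, the one chosen by the
   bit [h m]; hence [beta h] determines [h]. *)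
have key h m : O (xi (nd (pre h m))) (beta h) /\
    (forall a, A (xi (nd (pre h m))) a -> le (beta h) a -> a = an (nd (pre h m)) (h m)).
  have [BE _ _] := BP z; have [Bb bl] := betaP h.
  split; first by apply: BE => //; apply: zP; exists (pre h m).
  move=> a Aa ha; have [_ acA _] := AP (xi (nd (pre h m))).
  apply: acA => //; apply: compat_le bl ha _.
  apply: rle_trans (chan _ _); exact: (lbP h m.+1).
have [[a Aa fa] fuq] := key f n; have [_ guq] := key g n.
have ef := fuq _ Aa fa; have := guq a; rewrite -IH -fg => /(_ Aa fa).
rewrite ef; case: (f n) (g n) => -[] // e; first by case: (anN _ e).
by case: (anN (nd (pre f n))).
Qed.

(* Each [p] with 2^omega compatible elements in the antichain [B x] is assigned one
   of them, [t x p], injectively; conditions in [V x] below [t x p] decide whether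
   [p] is in the generic filter. *)
Lemma deciding_dense_sets : exists V : W -> set P, [/\ forall x, open (V x),
  forall x, dense (V x) &
  forall p, exists x,
    exists2 r, le r p & forall v, V x v -> compat le v r -> le v p].
Proof.
have [B [acB [Bmax Bmany]]] := many_compatible.
pose J x := [set p | exists beta : C -> P,
    injective beta /\ forall f, B x (beta f) /\ compat le (beta f) p].
have /choice[t tP] x := @injective_choice P C P p0 code (J x)
  (fun p b => B x b /\ compat le b p) code_inj (fun p => id).
pose V x v := exists b, [/\ B x b, le v b &
  forall p, J x p -> b = t x p -> le v p \/ ~ compat le v p].
exists V; split=> [x p q qp [b [Bb pb bp]]|x p|p].
- exists b; split=> // [|r Jr /bp-/(_ Jr)[pr|npr]]; first exact: rle_trans pb.
    by left; exact: rle_trans pr.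
  by right => qr; apply: npr; apply: compat_le qr _ _.
- have [b Bb [r rb rp]] := Bmax x p; have [_ tI] := tP x.
  have [[q [Jq bq]]|nq] := pselect (exists q, J x q /\ b = t x q); last first.
    exists r => //; exists b; split=> // q Jq bq; exfalso; apply: nq.
    by exists q.
  have uq q' : J x q' -> b = t x q' -> q' = q.
    by move=> Jq'; rewrite bq => e; apply: tI; rewrite ?inE.
  have [[s sr sq]|nc] := pselect (compat le r q).
    exists s; first exact: rle_trans rp.
    exists b; split=> // [|q' Jq' /(uq _ Jq')->]; first exact: rle_trans rb.
    by left.
  exists r => //; exists b; split=> // q' Jq' /(uq _ Jq')->; by right.
- have [x Jp] := Bmany p; have [tX tI] := tP x.
  have [Bt [r rt rp]] := tX _ Jp.
  exists x, r => // v [b [Bb vb bP]] vr.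
  have bt : b = t x p by apply: acB Bb Bt _; apply: compat_le vr _ _.
  have [//|[]] := bP _ Jp bt; apply: compat_le vr _ _ => //.
Qed.

(** The successor step of the tree. A suitable maximal antichain inside [O] has at least 2^omega
    members by [many_compatible] and at most that many by [code], so [C] indexes it exactly. The
    choice depends on [x] and [O] only, so branches with the same past receive the same children. *)
Lemma antichain_selector : exists (V : W -> set P) (sel : W -> set P -> C -> P),
  (forall p, exists x,
     exists2 r, le r p & forall v, V x v -> compat le v r -> le v p) /\
  (forall x (O : set P), open O -> O !=set0 ->
    [/\ forall c, O (sel x O c), forall c, V x (sel x O c),
    forall c c', compat le (sel x O c) (sel x O c') -> c = c' &
    forall q, O q -> exists c, compat le (sel x O c) q]).
Proof.
have [V [Vop Vde Vdec]] := deciding_dense_sets; exists V.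
suff /choice[sel selP] (xO : W * set P) : exists s : C -> P,
    open xO.2 -> xO.2 !=set0 ->
    [/\ forall c, xO.2 (s c), forall c, V xO.1 (s c),
    forall c c', compat le (s c) (s c') -> c = c' &
    forall q, xO.2 q -> exists c, compat le (s c) q].
  by exists (fun x O => sel (x, O)); split=> // x O; exact: (selP (x, O)).
case: xO => x O /=.
have [[Oop [p Op]]|nO] := pselect (open O /\ O !=set0); last first.
  by exists (fun=> p0) => Oop On; case: nO.
have [B [acB [_ Bmany]]] := many_compatible.
have [z [beta [betaI betaP]]] := Bmany p.
have /choice[r rP] c : exists q, [/\ le q (beta c), O q & V x q].
  have [_ [q qb qp]] := betaP c; have [q' q'q Vq'] := Vde x q.
  exists q'; split=> //; first exact: rle_trans qb.
  by apply: Oop Op; exact: rle_trans qp.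
have rac c c' : compat le (r c) (r c') -> c = c'.
  move=> rc; apply: betaI; apply: (acB z); [exact: (betaP c).1|exact: (betaP c').1|].
  have [? _ _] := rP c; have [? _ _] := rP c'; exact: compat_le rc _ _.
have [||A [rA AOV acA Amax]] := @antichain_extension (range r) (O `&` V x).
- by move=> _ [c _ <-]; have [_ ? ?] := rP c.
- by move=> _ _ [c _ <-] [c' _ <-] /rac->.
have [|c||s [sI sA]] := @bijection_onto C P (fun=> true) A r code.
- by move=> c c' rcc'; apply: rac; rewrite rcc'; exists (r c').
- by apply: rA; exists c.
- by move=> q q' _ _ /code_inj.
have As c : A (s c) by rewrite -sA; exists c.
exists s => _ _; split=> [c|c|c c' cc'|q Oq].
- by have [] := AOV _ (As c).
- by have [] := AOV _ (As c).
- exact/sI/acA.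
- have [q' q'q Vq'] := Vde x q.
  have [|a] := Amax q'; first by split=> //; exact: Oop Oq.
  rewrite -sA => -[c _ <-] scq'; exists c; exact: compat_le scq' _ _.
Qed.

(** The pair [(b, x)] stands for the restriction of [b] to the points up to and including [x],
    whence the successor length. Beyond [x], [b] is arbitrary, so a node has many
    representatives. *)
Definition node_le (t' t : (W -> C) * W) :=
  t.2 <= t'.2 /\ forall y, y <= t.2 -> t'.1 y = t.1 y.

(** Density of the tree: level [x] is a maximal antichain contained in [V x]. If [V x] decides [p]
    below the witness [r], a node of level [x] compatible with [r] is therefore below [p]. *)
Lemma tree_embedding : exists e : (W -> C) * W -> P,
  [/\ forall t' t, node_le t' t -> le (e t') (e t),
      forall t t', compat le (e t) (e t') -> compat node_le t t' &
      forall p, exists t, le (e t) p].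
Proof.
have [V [sel [Vdec selP]]] := antichain_selector.
have [woW _ segW] := homega1.
(* The children of the branch [b] below level [x] are indexed by [C] through an
   antichain that is maximal among the lower bounds of the branch. *)
pose F (b : W -> C) x (rec : forall y, y < x -> P) :=
  sel x [set q | forall y (h : y < x), le q (rec y h)] (b x).
have /choice[e eE] b := wf_rec (wo_wf woW) (F b).
pose LB b x := [set q | forall y, y < x -> le q (e b y)].
have {}eE b x : e b x = sel x (LB b x) (b x) by rewrite eE.
have LBop b x : open (LB b x).
  by move=> p q qp pLB y /pLB; exact: rle_trans.
have wind := well_founded_ind (wo_wf woW).
have eLB b x : LB b x (e b x) /\ LB b x !=set0.
  elim/wind: x => x IH; suff LB0 : LB b x !=set0.
    by split=> //; rewrite eE; have [] := selP x _ (@LBop b x) LB0.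
  have [|q qLB] := @chain_lower_bound _ W [set y | y < x] (e b) (segW x).
    move=> i j /= ix jx; rewrite le_eqVlt => /orP[/eqP->//|ij].
    by have [+ _] := IH _ jx; apply.
  by exists q.
have edec b x y : x <= y -> le (e b y) (e b x).
  rewrite le_eqVlt => /orP[/eqP->//|xy]; by have [+ _] := eLB b y; apply.
have eagree b b' x : (forall y, y <= x -> b y = b' y) -> e b x = e b' x.
  elim/wind: x => x IH bb'; rewrite !eE bb' //; congr (sel _ _ _).
  suff e_eq y : y < x -> e b y = e b' y.
    by apply/seteqP; split=> q qLB y yx; have := qLB y yx; rewrite e_eq.
  by move=> yx; apply: IH => // z zy; apply: bb'; apply: le_trans zy (ltW yx).
have esep b b' x y : x <= y -> compat le (e b x) (e b' y) ->
    forall z, z <= x -> b z = b' z.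
  move=> xy ebb' z; elim/wind: z => z IH zx.
  have bb' v : v < z -> b v = b' v.
    by move=> vz; apply: IH => //; apply: le_trans (ltW vz) zx.
  have eqLB : LB b z = LB b' z.
    have e_eq v : v < z -> e b v = e b' v.
      by move=> vz; apply: eagree => w wv; apply: bb'; exact: le_lt_trans wv vz.
    by apply/seteqP; split=> q qLB v vz; have := qLB v vz; rewrite e_eq.
  have [_ LB0] := eLB b z; have [_ _ + _] := selP z _ (@LBop b z) LB0.
  apply; rewrite {2}eqLB -!eE; apply: compat_le ebb' _ _; apply: edec => //.
  exact: le_trans zx xy.
pose O x q := exists b, le q (e b x).
have Oop x : open (O x).
  by move=> p q qp [b pb]; exists b; exact: rle_trans pb.
have Ode x : dense (O x).
  elim/wind: x => x IH p.
  have [q qp qO] := @dense_bigcap W [set y | y < x] O (segW x) Oop IH p.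
  have /choice[bs bsP] y : exists b, y < x -> le q (e b y).
    have [yx|nyx] := pselect (y < x); last by exists (fun _ _ => true).
    by have [b qb] := qO _ yx; exists b.
  (* [bs y] passes through a node above [q] at level [y]. Nodes above [q] are compatible, so by
     [esep] these branches agree and their diagonal is one branch bounded below by [q]. *)
  pose b y := bs y y.
  have qLB : LB b x q.
    move=> y yx; have qy := bsP _ yx; rewrite (@eagree b (bs y)) // => z zy.
    have zx := le_lt_trans zy yx.
    apply: (@esep (bs z) (bs y) z y zy) => //.
    by exists q => //; exact: bsP.
  have LB0 : LB b x !=set0 by exists q.
  have [_ _ _ /(_ q qLB)[c [r rc rq]]] := selP x _ (@LBop b x) LB0.
  exists r; first exact: rle_trans rq qp.
  exists (fun y => if y == x then c else b y).
  rewrite eE eqxx; suff -> : LB (fun y => if y == x then c else b y) x = LB b x by [].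
  have e_eq v : v < x -> e (fun y => if y == x then c else b y) v = e b v.
    move=> vx; apply: eagree => w wv; have := le_lt_trans wv vx.
    by rewrite lt_neqAle => /andP[/negPf->].
  by apply/seteqP; split=> s sLB v vx; have := sLB v vx; rewrite e_eq.
have eV b x : V x (e b x).
  have [_ LB0] := eLB b x; have [_ + _ _] := selP x _ (@LBop b x) LB0.
  by rewrite eE; apply.
exists (fun t => e t.1 t.2); split=> [[b' x'] [b x] [/= xx' bb']|[b x] [b' x'] /=|p].
- apply: rle_trans (edec _ _ _ xx') _; rewrite (@eagree b' b) //.
- move=> ebb'; have [xx'|/ltW x'x] := leP x x'.
    exists (b', x'); split=> //= y yx; exact/esym/(esep _ _ _ _ xx' ebb').
  exists (b, x); split=> //= y yx.
  by apply/esym; apply: (esep _ _ _ _ x'x (compat_sym ebb')).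
- have [x [r rp rV]] := Vdec p; have [q qr [b qb]] := Ode x r.
  by exists (b, x); apply: rV => //; exists q.
Qed.

End refinements.

(** * Posets sharing a dense tree *)

Definition dense_embedding (T : Type) (tle : T -> T -> Prop) (P : Type)
    (le : P -> P -> Prop) (e : T -> P) : Prop :=
  [/\ forall t' t, tle t' t -> le (e t') (e t),
      forall t t', compat le (e t) (e t') -> compat tle t t' &
      forall p, exists t, le (e t) p].

Section separative_order.
Context {d : Order.disp_t} {P : preorderType d}.

(** The order of the separative quotient, without identifying conditions. It is needed because
    inclusion of copies is not separative: removing one point can give a smaller copy compatible
    with the same copies. *)
Definition sep_le (p q : P) : Prop := f_gen q p.

Lemma sep_leW p q : p <= q -> sep_le p q.
Proof. by move=> pq r rp; exists r => //; exact: le_trans rp pq. Qed.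

Lemma sep_le_refl p : sep_le p p. Proof. exact: sep_leW. Qed.

Lemma sep_le_trans q p r : sep_le p q -> sep_le q r -> sep_le p r.
Proof.
move=> pq qr s sp; have [t ts tq] := pq s sp; have [u ut ur] := qr t tq.
by exists u => //; exact: le_trans ut ts.
Qed.

Lemma sep_compat p q : compat sep_le p q -> exists2 r, r <= p & r <= q.
Proof.
move=> [r rp rq]; have [s sr sp] := rp r (lexx r); have [t ts tq] := rq s sr.
by exists t => //; exact: le_trans ts sp.
Qed.

Lemma sep_le_sep p q : (forall r, sep_le r p -> compat sep_le r q) -> sep_le p q.
Proof.
by move=> pq r rp; have [s sr sq] := sep_compat (pq r (sep_leW rp)); exists s.
Qed.

End separative_order.

(** The two generic filters correspond to the same filter of nodes: [sigma] puts [q] into [H] when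
    some node [t] with [e t] in the filter has [e' t] below [q], and [tau] translates back in the
    same way. *)
Lemma generic_extensions_sub_embedding (T : Type) (tle : T -> T -> Prop)
    d (P : preorderType d) d' (Q : preorderType d') (e : T -> P) (e' : T -> Q) :
  dense_embedding tle sep_le e -> dense_embedding tle sep_le e' ->
  generic_extensions_sub P Q.
Proof.
move=> [emon ecomp edense] [fmon fcomp fdense].
have below (u : P) t : compat sep_le u (e t) ->
    exists2 t', tle t' t & sep_le (e t') u.
  move=> /sep_compat[r ru rt]; have [s sr] := edense r.
  have [|t' t's t't] := ecomp s t.
    by exists (e s); [exact: sep_le_refl|apply: sep_le_trans sr (sep_leW rt)].
  exists t' => //; apply: sep_le_trans (emon _ _ t's) _.
  exact: sep_le_trans sr (sep_leW ru).
have fbelow t q : sep_le q (e' t) -> exists2 t', tle t' t & sep_le (e' t') q.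
  move=> qt; have [s sq] := fdense q.
  have [|t' t's t't] := fcomp s t.
    by exists (e' s); [exact: sep_le_refl|exact: sep_le_trans sq qt].
  by exists t' => //; exact: sep_le_trans (fmon _ _ t's) sq.
pose sigma (q : Q) : set P := [set p | exists2 t, p = e t & sep_le (e' t) q].
pose tau (p : P) : set Q := [set q | exists2 t, q = e' t & sep_le (e t) p].
(* [HI] and [HE] reduce membership in [H] to nodes, so that the clauses of genericity become
   statements about the tree. *)
have HI q (s : P) t : s <= e t -> sep_le (e' t) q -> f_val f_gen sigma q s.
  move=> st tq r rs; exists r => //; exists (e t); split; first by exists t.
  exact/sep_leW/(le_trans rs).
have HE q (r : P) : f_val f_gen sigma q r ->
    forall r', r' <= r -> exists t, sep_le (e t) r' /\ sep_le (e' t) q.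
  move=> Hr r' r'r; have [s sr' [_ [[t -> tq] st]]] := Hr r' r'r.
  have [|t' t't t's] := below s t; first by exists s; [exact: sep_le_refl|exact: st].
  exists t'; split; first exact: sep_le_trans t's (sep_leW sr').
  exact: sep_le_trans (fmon _ _ t't) tq.
move=> p; exists p => //; exists sigma, tau; split; [split; [|split]|].
- move=> a b r rp [ab Ha] r' r'r; have [t [tr' ta]] := HE _ _ Ha _ r'r.
  have [s st sr'] := tr' (e t) (lexx _); exists s => //; exists (e t).
  split; first by exists t => //; apply: sep_le_trans ta (sep_leW _).
  exact: sep_leW.
- move=> a b r rp [Ha Hb] r' r'r; have [t [tr' ta]] := HE _ _ Ha _ r'r.
  have [s st sr'] := tr' (e t) (lexx _).
  have [t1 [t1s t1b]] := HE _ _ Hb s (le_trans sr' r'r).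
  have [|u ut1 ut] := ecomp t1 t.
    by exists (e t1); [exact: sep_le_refl|apply: sep_le_trans t1s (sep_leW st)].
  have ua := sep_le_trans (fmon _ _ ut) ta.
  have ub := sep_le_trans (fmon _ _ ut1) t1b.
  have [c1 c1u c1a] := ua (e' u) (lexx _).
  have [c cc1 cb] := ub c1 c1u.
  have [v vu vc] := fbelow u c (sep_leW (le_trans cc1 c1u)).
  have vr' : sep_le (e v) r'.
    apply: sep_le_trans (emon _ _ vu) (sep_le_trans (emon _ _ ut1) _).
    exact: sep_le_trans t1s (sep_leW sr').
  have [w wv wr'] := vr' (e v) (lexx _); exists w => //; exists c.
  split; first by split=> //; exact: le_trans cc1 c1a.
  exact: HI wv vc.
- move=> D r rp Ddense r' r'r; have [t tr'] := edense r'.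
  have [q qt Dq] := Ddense (e' t); have [u ut uq] := fbelow t q (sep_leW qt).
  have [w wu wr'] := sep_le_trans (emon _ _ ut) tr' (lexx _).
  by exists w => //; exists q; split=> //; exact: HI wu uq.
- move=> t0; split=> r rp.
    move=> rt0 r' r'r; have [t tr'] := edense r'.
    have [w wt wr'] := tr' (e t) (lexx _); exists w => //; exists (e' t); split.
      exists t => //; apply: sep_le_trans tr' (sep_le_trans (sep_leW r'r) rt0).
    by apply: HI wt _; exact: sep_le_refl.
  move=> Hr r' r'r; have [s sr' [_ [[t -> tt0] Hs]]] := Hr r' r'r.
  have [t1 [t1s t1t]] := HE _ _ Hs s (lexx _).
  have [|u ut1 ut] := fcomp t1 t; first by exists (e' t1); [exact: sep_le_refl|].
  have us := sep_le_trans (emon _ _ ut1) t1s.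
  have [w wu ws] := us (e u) (lexx _).
  have [x xw xt0] := sep_le_trans (emon _ _ ut) tt0 wu.
  by exists x => //; exact: le_trans xw (le_trans ws sr').
Qed.

Lemma forcing_equivalent_embedding (T : Type) (tle : T -> T -> Prop)
    d (P : preorderType d) d' (Q : preorderType d') (e : T -> P) (e' : T -> Q) :
  dense_embedding tle sep_le e -> dense_embedding tle sep_le e' ->
  forcing_equivalent P Q.
Proof. by move=> eP eQ; split; apply: generic_extensions_sub_embedding; eassumption. Qed.

(** * Subsets of a countable ordinal up to embedding *)

Section embeddings.
Context {d : Order.disp_t} {a : orderType d}.
Implicit Types A B U K : set a.

Definition incr_on A (f : a -> a) := forall x y, A x -> A y -> x < y -> f x < f y.

Definition emb A B := exists2 f : a -> a, incr_on A f & forall x, A x -> B (f x).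

Lemma emb_sub A B : A `<=` B -> emb A B.
Proof. by move=> AB; exists id. Qed.

Lemma emb_refl A : emb A A.
Proof. by exists id. Qed.

Lemma emb_trans B A A' : emb A B -> emb B A' -> emb A A'.
Proof.
move=> [f fi fA] [g gi gB]; exists (g \o f) => [x y Ax Ay xy|x Ax] /=.
  by apply: gi; [exact: fA|exact: fA|exact: fi].
exact/gB/fA.
Qed.

Lemma incr_on_le A f x y : incr_on A f -> A x -> A y -> x <= y -> f x <= f y.
Proof.
by move=> fi Ax Ay; rewrite le_eqVlt => /orP[/eqP->//|xy]; exact/ltW/fi.
Qed.

Lemma incr_on_mono A f : incr_on A f -> {in A &, {mono f : x y / x < y}}.
Proof.
move=> fi x y /set_mem Ax /set_mem Ay; apply/idP/idP => [|xy]; last exact: fi.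
by apply: contraTT; rewrite -!leNgt; exact: incr_on_le fi _ _.
Qed.

Definition tl U (x : a) : set a := [set z | U z /\ x <= z].

Definition initial U := forall x y, U y -> x <= y -> U x.

(* For [U] an ordinal, the classes are the blocks of the Cantor normal form of
   [U], with equal powers of omega in different blocks. *)
Definition cl U (x : a) : set a :=
  [set z | [/\ U z, emb (tl U z) (tl U x) & emb (tl U x) (tl U z)]].

Lemma cl_self U x : U x -> cl U x x.
Proof. by split=> //; exact: emb_refl. Qed.

Lemma cl_eq U x y : cl U x y -> cl U y = cl U x.
Proof.
move=> [Uy yx xy]; apply/seteqP; split=> z [Uz z1 z2]; split=> //.
- exact: emb_trans z1 yx.
- exact: emb_trans xy z2.
- exact: emb_trans z1 xy.
- exact: emb_trans yx z2.
Qed.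

Lemma tl_sub U x y : x <= y -> tl U y `<=` tl U x.
Proof. by move=> xy z [Uz yz]; split=> //; exact: le_trans yz. Qed.

Lemma cl_convex U x y z z' : initial U -> cl U x z -> cl U x z' ->
  z <= y -> y <= z' -> cl U x y.
Proof.
move=> Ui [Uz zx xz] [Uz' zx' xz'] zy yz'; split; first exact: Ui yz'.
  by apply: emb_trans zx; apply: emb_sub; exact: tl_sub.
by apply: emb_trans xz' _; apply: emb_sub; exact: tl_sub.
Qed.

Lemma cl_lt U z z' u v : U z' -> z < z' -> ~ cl U z z' -> cl U z u ->
  cl U z' v -> u < v.
Proof.
move=> Uz' zz' nzz' [Uu uz zu] [Uv vz' z'v]; rewrite ltNge; apply/negP => vu.
apply: nzz'; split=> //; first by apply: emb_sub; apply: tl_sub; exact: ltW.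
apply: emb_trans zu (emb_trans _ vz'); apply: emb_sub; exact: tl_sub.
Qed.

Context (wo : well_order (<=%O : rel a)).

Lemma incr_on_ge A f x : incr_on A f -> (forall x, A x -> A (f x)) -> A x -> x <= f x.
Proof.
move=> fi fA Ax; rewrite leNgt; apply/negP => fxx.
have [m [Am fmm] mmin] := wo_min wo (A := [set x | A x /\ f x < x])
  (ex_intro _ x (conj Ax fxx)).
have := mmin (f m); rewrite leNgt fmm.
by move=> /(_ (conj (fA _ Am) (fi _ _ (fA _ Am) Am fmm))).
Qed.

(** The Mostowski collapse of [A]: [r x] is the least point above all [r y] with [y] in [A] below
    [x]. It exists because [x] itself is such a bound, whence also [r x <= x]. *)
Lemma collapse A : exists r : a -> a, [/\ incr_on A r, forall x, r x <= x &
  forall x y, y < r x -> exists x', [/\ A x', x' < x & r x' = y]].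
Proof.
pose bnd x (rec : forall y, y < x -> a) z := forall y (h : y < x), A y -> rec y h < z.
pose F x rec := xget x [set z | bnd x rec z /\ forall z', bnd x rec z' -> z <= z'].
have [r rE] := wf_rec (wo_wf wo) F.
have rP x : [/\ forall y, y < x -> A y -> r y < r x,
    forall z, (forall y, y < x -> A y -> r y < z) -> r x <= z & r x <= x].
  elim/(well_founded_ind (wo_wf wo)): x => x IH.
  have bx : bnd x (fun y _ => r y) x.
    by move=> y yx _; have [_ _ ryy] := IH _ yx; exact: le_lt_trans yx.
  have [m mb mmin] := wo_min wo (ex_intro _ x bx).
  have [|b l] := @xgetPex _ x
    [set z | bnd x (fun y _ => r y) z /\ forall z', bnd x (fun y _ => r y) z' -> z <= z'].
    by exists m.
  by rewrite rE; split=> //; exact: l.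
exists r; split => [x y Ax _ xy|x|x y yrx].
- by have [+ _ _] := rP y; apply.
- by have [_ _] := rP x.
- have [_ rl _] := rP x.
  have [z [Az zx yrz]] : exists z, [/\ A z, z < x & y <= r z].
    apply: contrapT => nz; move: yrx; rewrite ltNge rl// => z zx Az.
    by rewrite ltNge; apply/negP => yrz; apply: nz; exists z.
  have [m [Am mx yrm] mmin] := wo_min wo
    (A := [set z | [/\ A z, z < x & y <= r z]]) (ex_intro _ z (And3 Az zx yrz)).
  exists m; split=> //; apply/eqP; rewrite eq_le yrm andbT.
  have [_ rm _] := rP m; apply: rm => w wm Aw; rewrite ltNge; apply/negP => yrw.
  by have := mmin w; rewrite leNgt wm => /(_ (And3 Aw (lt_trans wm mx) yrw)).
Qed.

Lemma collapse_emb A : exists J, [/\ initial J, emb A J, emb J A &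
  forall z, J z -> exists2 x, A x & z <= x].
Proof.
have [r [ri rle rsurj]] := collapse A; exists (r @` A); split.
- move=> x y [z Az <-]; rewrite le_eqVlt => /orP[/eqP->|]; first by exists z.
  by move=> /rsurj[x' [Ax' _ <-]]; exists x'.
- by exists r => // x Ax; exists x.
- have /choice[s sP] z : exists x, (r @` A) z -> A x /\ r x = z.
    have [[x Ax <-]|nz] := pselect ((r @` A) z); first by exists x.
    by exists z.
  exists s => [x y /sP[Ax xE] /sP[Ay yE]|x /sP[]//].
  by rewrite -{1}xE -{1}yE (incr_on_mono ri) //; exact: mem_set.
- by move=> z [x Ax <-]; exists x.
Qed.

Lemma emb_total A B : emb A B \/ emb B A.
Proof.
have [J [Ji AJ JA _]] := collapse_emb A; have [L [Li BL LB _]] := collapse_emb B.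
have [JL|/existsNP[x /not_implyP[Jx nLx]]] := pselect (J `<=` L).
  by left; apply: emb_trans AJ _; apply: emb_trans LB; exact: emb_sub.
right; apply: emb_trans BL _; apply: emb_trans JA; apply: emb_sub => y Ly.
have [yx|xy] := leP y x; first exact: Ji yx.
by case: nLx; apply: Li Ly _; exact: ltW.
Qed.

(** An embedding into [A] followed by the collapse of [A] is an increasing self-map, which moves no
    point down; so the collapse of [A] is onto. From here on copies are recognised by embeddings
    alone. *)
Lemma is_copyP A : is_copy A <-> emb [set: a] A.
Proof.
split=> [[f [[_ _ fs] fm]]|[f fi fA]].
  have /choice[g gP] z : exists x, A x /\ f x = z.
    by have [x Ax <-] := fs z I; exists x.
  exists g => [x y _ _ xy|x _]; last exact: (gP x).1.
  by rewrite -fm ?(gP _).2 //; apply/mem_set; exact: (gP _).1.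
have [r [ri rle rs]] := collapse A; exists r; split; last exact: incr_on_mono.
split=> // [x y /set_mem Ax /set_mem Ay rxy|z _].
  by case: (ltgtP x y) => // [/(ri _ _ Ax Ay)|/(ri _ _ Ay Ax)]; rewrite rxy ltxx.
have : z <= (r \o f) z.
  apply: (@incr_on_ge [set: a]) => // x y _ _ xy /=.
  by apply: ri; [exact: fA|exact: fA|exact: fi].
rewrite le_eqVlt => /orP[/eqP->|/rs[x [Ax _ <-]]]; last by exists x.
by exists (f z) => //; exact: fA.
Qed.

(** Blocks are additively indecomposable: an embedding of the tail at the least point of the block
    into the tail at [y] moves points up and carries tails into tails, so it keeps the block inside
    itself. *)
Lemma cl_tail U x y : initial U -> cl U x y -> emb (cl U x) (tl (cl U x) y).
Proof.
move=> Ui xy; have [x0 xx0 x0min] := wo_min wo (ex_intro _ y xy).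
have [_ x0x _] := xx0; have [_ _ xy'] := xy.
have [g gi gt] := emb_trans x0x xy'.
have tx0 z : cl U x z -> tl U x0 z by move=> xz; split; [case: xz|exact: x0min].
have tyx0 z : tl U y z -> tl U x0 z by apply: tl_sub; exact: x0min.
exists g => [z w /tx0 xz /tx0 xw|z xz]; first exact: gi.
have tz := tx0 _ xz; have [Ugz ygz] := gt _ tz; split=> //.
have zgz : z <= g z.
  by apply: incr_on_ge gi _ tz => w /gt/tyx0.
have [Uz zx xz'] := xz; split=> //.
  by apply: emb_trans zx; apply: emb_sub; exact: tl_sub.
apply: emb_trans xz' _; exists g => [w w' tw tw'|w [Uw zw]].
  by apply: gi; [apply: tl_sub tw|apply: tl_sub tw']; case: tz.
have tw : tl U x0 w by split=> //; case: tz => _ x0z; exact: le_trans x0z zw.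
split; first by have [] := gt _ tw.
exact: incr_on_le gi tz tw zw.
Qed.

(** As [f y] is not below [y] and [f] carries the tail at [y] into the tail at [f y], the two tails
    embed in each other. This is what lets copies be treated block by block. *)
Lemma cl_preserved f x y : incr_on [set: a] f -> cl setT x y -> cl setT x (f y).
Proof.
move=> fi [_ yx xy]; split=> //.
  apply: emb_trans yx; apply: emb_sub; apply: tl_sub.
  exact: (@incr_on_ge [set: a]).
apply: emb_trans xy _; exists f => [z z' _ _|z [_ yz]]; first exact: fi.
by split=> //; exact: incr_on_le fi _ _ _.
Qed.

Lemma emb_glue B :
  (forall x, exists2 h, incr_on (cl setT x) h & forall z, cl setT x z ->
     cl setT x (h z) /\ B (h z)) -> emb setT B.
Proof.
move=> hex; have [[p0 _]|na] := pselect (exists x : a, True); last first.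
  by exists id => x; case: na; exists x.
have /choice[h hP] x : exists h, incr_on (cl setT x) h /\ forall z, cl setT x z ->
     cl setT x (h z) /\ B (h z) by have [h] := hex x; exists h.
have clT x : cl setT x x by exact: cl_self.
(* [m] picks one representative per block, so that all points of a block use the same [h]. *)
have /choice[m mP] K : exists x, forall y, K = cl setT y -> K x.
  have [[y ->]|nK] := pselect (exists y, K = cl setT y); first by exists y.
  by exists p0 => y Ky; case: nK; exists y.
pose H z := h (m (cl setT z)) z.
have clm z : cl setT (m (cl setT z)) = cl setT z by apply: cl_eq; exact: mP.
have HP z : cl setT z (H z) /\ B (H z).
  have [_ /(_ z)] := hP (m (cl setT z)); rewrite clm; apply; exact: clT.
exists H => [x y _ _ xy|x _]; last exact: (HP x).2.
have [xcy|nxcy] := pselect (cl setT x y).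
  rewrite /H -(cl_eq xcy); have [+ _] := hP (m (cl setT y)); rewrite clm; apply=> //.
  by rewrite (cl_eq xcy).
exact: cl_lt nxcy (HP x).1 (HP y).1.
Qed.

Lemma cofinal_sequence K : countable K -> K !=set0 ->
  (forall x, K x -> exists2 y, K y & x < y) ->
  exists u : nat -> a, [/\ forall n, K (u n), forall n, u n < u n.+1 &
    forall x, K x -> exists n, x < u n].
Proof.
move=> Kc K0 Knx; have [e eK] := countable_range Kc K0.
have Ke n : K (e n) by rewrite -eK; exists n.
have /choice[nx nxP] x : exists y, K x -> K y /\ x < y.
  have [/Knx[y Ky xy]|nK] := pselect (K x); first by exists y.
  by exists x.
pose fix u n := if n is n'.+1 then nx (Order.max (u n') (e n')) else e 0.
have uS n : u n.+1 = nx (Order.max (u n) (e n)) by [].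
have Kmax x y : K x -> K y -> K (Order.max x y) by rewrite /Order.max; case: ifP.
have Ku n : K (u n).
  elim: n => [|n IH]; first exact: Ke.
  by rewrite uS; apply: (nxP _ _).1; exact: Kmax.
have ux n : Order.max (u n) (e n) < u n.+1.
  by rewrite uS; apply: (nxP _ _).2; exact: Kmax.
exists u; split=> // [n|x]; first by have := ux n; rewrite gt_max => /andP[].
rewrite -eK => -[n _ <-]; exists n.+1.
by have := ux n; rewrite gt_max => /andP[].
Qed.

Lemma increasing_seq_le (u : nat -> a) : (forall n, u n < u n.+1) ->
  forall m n, (m <= n)%N -> u m <= u n.
Proof.
move=> uS m n; elim: n => [|n IH]; first by rewrite leqn0 => /eqP->.
rewrite leq_eqVlt => /orP[/eqP->//|/IH mn]; exact: le_trans mn (ltW (uS n)).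
Qed.

Lemma first_above (u : nat -> a) x : (exists n, x < u n) ->
  exists n, x < u n /\ forall m, (m < n)%N -> u m <= x.
Proof.
move=> ex; exists (ex_minn ex); case: ex_minnP => n xn nmin; split=> // m mn.
by rewrite leNgt; apply/negP => /nmin; rewrite leqNgt mn.
Qed.

(** By [cl_tail], a block with a last point embeds into that point alone. *)
Lemma cl_max x y : cl setT x y -> (forall z, cl setT x z -> z <= y) ->
  forall z, cl setT x z -> z = y.
Proof.
move=> xy ymax z xz; have [g gi gt] := cl_tail (fun _ _ _ _ => I) xy.
have gy w : cl setT x w -> g w = y.
  by move=> /gt[Kgw ygw]; apply/eqP; rewrite eq_le ygw ymax.
have := ymax _ xz; rewrite le_eqVlt => /orP[/eqP//|zy].
by have := gi _ _ xz xy zy; rewrite !gy // ltxx.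
Qed.

(** * Sigma-closure: diagonalising inside blocks *)

Context (countT : countable [set: a]).

Lemma countable_sub A : countable A.
Proof. exact: sub_countable (subset_card_le (@subsetT _ A)) countT. Qed.

(** A cofinal sequence [u] cuts the block, and the [n]-th piece is sent through [f n] after a shift
    past [b n]. As [b n.+1] is the image of [u n] under this map, the pieces stay in order, and all
    values above [b n] come from some [f m] with [n <= m]. *)
Lemma class_pseudo_intersection (f : nat -> a -> a) x :
  (forall n, incr_on setT (f n)) ->
  exists B, (exists2 h, incr_on (cl setT x) h &
      forall z, cl setT x z -> cl setT x (h z) /\ B (h z)) /\
    forall n, exists2 b, cl setT x b & forall y, B y -> b <= y ->
      exists2 m, (n <= m)%N & range (f m) y.
Proof.
move=> fi; set K := cl setT x; have Kx : K x by exact: cl_self.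
have iT : initial setT by [].
have Kf n y : K y -> K (f n y) by exact: cl_preserved.
have ft y : K y -> exists g, incr_on K g /\ forall z, K z -> tl K y (g z).
  by move=> /(cl_tail iT)[g]; exists g.
have [[y [Ky ymax]]|nmax] := pselect (exists y, K y /\ forall z, K z -> z <= y).
  have Ky1 := cl_max Ky ymax.
  exists K; split; first by exists id.
  move=> n; exists y => // z Kz _; exists n => //; exists z => //.
  by rewrite (Ky1 _ Kz) (Ky1 (f n y)) //; exact: Kf.
have [||u [Ku uS ucof]] := @cofinal_sequence K (countable_sub K).
- by exists x.
- move=> y Ky; apply: contrapT => ny; apply: nmax; exists y; split=> // z Kz.
  by rewrite leNgt; apply/negP => yz; apply: ny; exists z.
have /choice[g gP] b : exists g, K b -> incr_on K g /\ forall z, K z -> tl K b (g z).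
  by have [/ft[g]|nK] := pselect (K b); [exists g|exists id].
pose fix b n := if n is n'.+1 then f n' (g (b n') (u n')) else u 0.
have Kb n : K (b n).
  elim: n => [|n IH]; first exact: Ku.
  by apply: Kf; have [_ /(_ _ (Ku n))[]] := gP _ IH.
have gi n : incr_on K (g (b n)) by have [] := gP _ (Kb n).
have gK n z : K z -> K (g (b n) z) /\ b n <= g (b n) z.
  by move=> Kz; have [_ /(_ _ Kz)[]] := gP _ (Kb n).
have fge n z : z <= f n z by apply: (@incr_on_ge setT).
have hge n z : K z -> b n <= f n (g (b n) z).
  by move=> Kz; apply: le_trans (gK n z Kz).2 (fge _ _).
have hi n z w : K z -> K w -> z < w -> f n (g (b n) z) < f n (g (b n) w).
  by move=> Kz Kw zw; apply: fi => //; exact: gi.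
have bS n : b n <= b n.+1 by exact: hge.
have ble m n : (m <= n)%N -> b m <= b n.
  elim: n => [|n IH]; first by rewrite leqn0 => /eqP->.
  rewrite leq_eqVlt => /orP[/eqP->//|/IH mn]; exact: le_trans mn (bS n).
have /choice[i iP] z : exists n, K z -> z < u n /\ forall m, (m < n)%N -> u m <= z.
  have [/ucof/first_above[n]|nK] := pselect (K z); first by exists n.
  by exists 0%N.
pose h z := f (i z) (g (b (i z)) z).
have hb z : K z -> h z < b (i z).+1.
  by move=> Kz; apply: hi => //; have [] := iP _ Kz.
exists (h @` K); split.
  exists h => [z w Kz Kw zw|z Kz]; last first.
    by split; [apply: Kf; exact: (gK _ _ Kz).1|exists z].
  have [[zi iz] [wi iw]] := (iP _ Kz, iP _ Kw).
  have : (i z <= i w)%N.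
    rewrite leqNgt; apply/negP => /iz wz; have := lt_trans (lt_le_trans wi wz) zw.
    by rewrite ltxx.
  rewrite leq_eqVlt => /orP[/eqP zw_eq|izw].
    by rewrite /h -zw_eq; exact: hi.
  exact: lt_le_trans (hb _ Kz) (le_trans (ble _ _ izw) (hge _ _ Kw)).
move=> n; exists (b n) => // _ [z Kz <-] bnh; exists (i z).
  rewrite leqNgt; apply/negP => /ble/(lt_le_trans (hb _ Kz)).
  by rewrite ltNge bnh.
by exists (g (b (i z)) z).
Qed.

(** In each block [B] lies in the late ranges only beyond a bound. Any copy inside [B] still
    contains a copy past all these bounds, because blocks embed in their own tails; hence the
    quantification over [C], which is inclusion in the separative sense. *)
Lemma pseudo_intersection (f : nat -> a -> a) : (forall n, incr_on setT (f n)) ->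
  exists B, emb setT B /\ forall n C, C `<=` B -> emb setT C ->
    emb setT (C `&` [set y | exists2 m, (n <= m)%N & range (f m) y]).
Proof.
move=> fi; have [[p0 _]|na] := pselect (exists x : a, True); last first.
  by exists setT; split=> [|n C _ _]; exists id => // x; case: na; exists x.
have clT x : cl setT x x by exact: cl_self.
pose good K B := (exists2 h, incr_on K h & forall z, K z -> K (h z) /\ B (h z)) /\
    forall n, exists2 b, K b & forall y, B y -> b <= y ->
      exists2 m, (n <= m)%N & range (f m) y.
have /choice[Bf BfP] K : exists B, forall x, K = cl setT x -> good K B.
  have [[x ->]|nK] := pselect (exists y, K = cl setT y).
    by have [B BP] := class_pseudo_intersection x fi; exists B.
  by exists set0 => y Ky; case: nK; exists y.
exists [set y | Bf (cl setT y) y]; split=> [|n C CB [c ci cC]].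
  apply: emb_glue => x; have [[h hi hB] _] := BfP _ x erefl.
  by exists h => // z /hB[xhz Bhz]; split=> //=; rewrite (cl_eq xhz).
apply: emb_glue => x; have [_ /(_ n)[b xb bP]] := BfP _ x erefl.
have [g gi gt] := cl_tail (fun _ _ _ _ => I) xb.
exists (c \o g) => [z w xz xw zw|z xz] /=; first by apply: ci => //; exact: gi.
have [xgz bgz] := gt _ xz; have xcgz : cl setT x (c (g z)) by exact: cl_preserved.
split=> //; have Cc := cC (g z) I; split=> //; apply: bP.
  by rewrite -(cl_eq xcgz); exact: CB.
by apply: le_trans bgz _; exact: (@incr_on_ge setT).
Qed.

End embeddings.

Lemma infinite_natP (X : set nat) :
  infinite_set X <-> forall k, exists2 m, (k <= m)%N & X m.
Proof.
split=> [Xinf k|Xub Xfin].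
  apply: contrapT => nk; apply: Xinf; apply: sub_finite_set (finite_II k) => m Xm /=.
  by rewrite ltnNge; apply/negP => km; apply: nk; exists m.
have /finite_seqP[s sX] := Xfin; have [m sm] := Xub (\max_(i <- s) i).+1.
by rewrite sX /= => ms; move: sm; rewrite ltnNge leq_bigmax_seq.
Qed.

(** * Indecomposable intervals of the first block, and the projection to subsets of nat *)

Section projection.
Context {d : Order.disp_t} {a : orderType d}.
Implicit Types A B U K : set a.
Context (wo : well_order (<=%O : rel a)).

Definition tail_indecomposable K := forall x, K x -> emb K (tl K x).

Lemma tl_indecomposable K x : tail_indecomposable K -> tail_indecomposable (tl K x).
Proof.
move=> Kti y [Ky xy]; apply: (@emb_trans _ _ K).
  by apply: emb_sub => z [].
apply: emb_trans (Kti _ Ky) _; apply: emb_sub => z [Kz yz]; split=> //.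
by split=> //; exact: le_trans yz.
Qed.

(** The Cantor normal form of the interval from [x] to [y], by induction on its order type [t x]:
    after leaving the block of [x] at [x'] the remaining type is strictly smaller, since otherwise
    [x'] would belong to that block. *)
Lemma interval_index y x : exists (p : a -> nat) N,
  [/\ forall z, x <= z -> z < y -> (p z < N)%N,
    forall z w, x <= z -> z <= w -> w < y -> (p z <= p w)%N &
    forall i, tail_indecomposable [set z | [/\ x <= z, z < y & p z = i]]].
Proof.
(* Blocks are taken inside the points below [y], so that the interval from [x] to [y] is a tail. *)
pose U := [set z | z < y].
have Ui : initial U by move=> v w /= wy vw; exact: le_lt_trans wy.
have /choice[t tP] z : exists t, emb (tl U z) [set w | w < t] /\
    emb [set w | w < t] (tl U z).
  have [J [Ji AJ JA Jle]] := collapse_emb wo (tl U z).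
  have nJy : ~ J y by move=> /Jle[w [wy _]]; rewrite leNgt wy.
  have [t nJt tmin] := wo_min wo (A := ~` J) (ex_intro _ y nJy).
  suff JE : J = [set w | w < t] by exists t; rewrite -JE.
  apply/seteqP; split=> [w Jw /=|w /= wt].
    by rewrite ltNge; apply/negP => tw; apply: nJt; exact: Ji Jw tw.
  by apply: contrapT => /tmin; rewrite leNgt wt.
move sE : (t x) => s; elim/(well_founded_ind (wo_wf wo)): s x sE => s IHs x sx.
have IH x1 : t x1 < t x -> _ := fun h =>
  IHs (t x1) (eq_ind (t x) (fun v => t x1 < v) h s sx) x1 erefl.
have [yx|xy] := leP y x.
  exists (fun=> 0%N), 0%N; split=> [z xz zy|//|i z [xz zy _]];
    by have := lt_le_trans zy (le_trans yx xz); rewrite ltxx.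
have ti : tail_indecomposable (tl (cl U x) x).
  by apply: tl_indecomposable => z; exact: cl_tail.
have Kx : cl U x x by exact: cl_self.
have [allK|] := pselect (forall z, x <= z -> z < y -> cl U x z).
  exists (fun=> 0%N), 1%N; split=> // -[|i] z [xz zy //] _.
  suff <- : tl (cl U x) x = [set z | [/\ x <= z, z < y & 0%N = 0%N]].
    by apply: ti; split=> //; exact: allK.
  apply/seteqP; split=> [w [[wy _ _] xw]|w [xw wy _]] //.
  by split=> //; exact: allK.
move=> /existsNP[z0 /not_implyP[xz0 /not_implyP[z0y nKz0]]].
have [x' [xx' x'y nKx'] x'min] := wo_min wo
  (A := [set z | [/\ x <= z, z < y & ~ cl U x z]])
  (ex_intro _ z0 (And3 xz0 z0y nKz0)).
have [|p [N [pN pm pti]]] := IH x'.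
  rewrite ltNge; apply/negP => txx'; apply: nKx'; split=> //.
    by apply: emb_sub; exact: tl_sub.
  apply: emb_trans (tP x).1 (emb_trans _ (tP x').2); apply: emb_sub => w /= wtx.
  exact: lt_le_trans txx'.
exists (fun z => if z < x' then 0%N else (p z).+1), N.+1; split.
- by move=> z xz zy; case: ltP => // x'z; rewrite ltnS pN.
- move=> z w xz zw wy; case: (ltP z x') => // x'z.
  by rewrite ltNge (le_trans x'z zw) /= ltnS pm.
- move=> [|i].
    suff -> : [set z | [/\ x <= z, z < y & (if z < x' then 0%N else (p z).+1) = 0%N]]
      = tl (cl U x) x by [].
    apply/seteqP; split=> [z [xz zy]|z [Kz xz]].
      case: ltP => // zx' _; split=> //; apply: contrapT => nKz.
      by have := x'min z (And3 xz zy nKz); rewrite leNgt zx'.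
    split=> //; first by case: Kz.
    case: ltP => // x'z; case: nKx'; exact: cl_convex Ui Kx Kz xx' x'z.
  suff -> : [set z | [/\ x <= z, z < y & (if z < x' then 0%N else (p z).+1) = i.+1]]
      = [set z | [/\ x' <= z, z < y & p z = i]] by exact: pti.
  apply/seteqP; split=> [z [xz zy]|z [x'z zy <-]].
    by case: ltP => // x'z [].
  by split=> //; [exact: le_trans xx' x'z|rewrite ltNge x'z].
Qed.

(** Each gap between consecutive [u n] consists of finitely many indecomposable intervals, and the
    offsets [o n] number all of them consecutively. Empty fibres of [p] are allowed. *)
Lemma block_index L (u : nat -> a) (m0 : a) : (forall z, m0 <= z) -> initial L ->
  (forall n, L (u n)) -> (forall n, u n < u n.+1) ->
  (forall z, L z -> exists n, z < u n) ->
  exists p : a -> nat, [/\ forall z w, L w -> z <= w -> (p z <= p w)%N,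
    forall i, tail_indecomposable [set z | L z /\ p z = i] &
    forall i, exists n, forall z, L z -> p z = i -> z < u n].
Proof.
move=> m0min Li Lu uS ucof.
pose lo n := if n is n'.+1 then u n' else m0.
have /choice[q qP] n : exists pN : (a -> nat) * nat,
  [/\ forall z, lo n <= z -> z < u n -> (pN.1 z < pN.2)%N,
    forall z w, lo n <= z -> z <= w -> w < u n -> (pN.1 z <= pN.1 w)%N &
    forall i, tail_indecomposable [set z | [/\ lo n <= z, z < u n & pN.1 z = i]]].
  by have [p [N pN]] := interval_index (u n) (lo n); exists (p, N).
have ule := increasing_seq_le uS.
have /choice[i iP] z : exists n, L z -> lo n <= z /\ z < u n.
  have [/ucof/first_above[n [zn nmin]]|nL] := pselect (L z); last by exists 0%N.
  by exists n => _; split=> //; case: n zn nmin => [|n] zn nmin //=; exact: nmin.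
have iE z n : lo n <= z -> z < u n -> L z /\ i z = n.
  move=> nz zn; have Lz : L z by apply: Li (Lu n) (ltW zn).
  split=> //; have [iz zi] := iP _ Lz.
  case: (ltngtP (i z) n) => // [|].
    case: n nz {zn} => //= n nz; rewrite ltnS => /ule izn.
    by have := lt_le_trans zi (le_trans izn nz); rewrite ltxx.
  case: (i z) iz {zi} => //= k kz; rewrite ltnS => /ule nk.
  by have := lt_le_trans zn (le_trans nk kz); rewrite ltxx.
pose o n := (\sum_(k < n) (q k).2)%N.
have oS n : o n.+1 = (o n + (q n).2)%N by rewrite /o big_ord_recr.
have ole m n : (m <= n)%N -> (o m <= o n)%N.
  elim: n => [|n IH]; first by rewrite leqn0 => /eqP->.
  rewrite leq_eqVlt => /orP[/eqP->//|/IH mn]; rewrite oS.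
  exact: leq_trans mn (leq_addr _ _).
pose p z := (o (i z) + (q (i z)).1 z)%N.
have pS z : L z -> (p z < o (i z).+1)%N.
  by move=> Lz; have [? ?] := iP _ Lz; have [h _ _] := qP (i z); rewrite oS ltn_add2l h.
have ilt z w : (i z < i w)%N -> L z -> (p z < p w)%N.
  by move=> /ole zw Lz; apply: leq_trans (pS _ Lz) (leq_trans zw (leq_addr _ _)).
have peq z w : L z -> L w -> p z = p w -> i z = i w.
  by move=> Lz Lw pe; case: (ltngtP (i z) (i w)) => // /ilt;
    [move=> /(_ Lz)|move=> /(_ Lw)]; rewrite pe ltnn.
exists p; split.
- move=> z w Lw zw; have Lz := Li _ _ Lw zw.
  have [[iz zi] [iw wi]] := (iP _ Lz, iP _ Lw).
  case: (ltngtP (i z) (i w)) => [zw'|wz|e]; first exact/ltnW/ilt.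
    exfalso; case: (i z) iz wz => //= k kz; rewrite ltnS => /ule wk.
    by have := lt_le_trans wi (le_trans wk (le_trans kz zw)); rewrite ltxx.
  rewrite /p -e leq_add2l; have [_ h _] := qP (i z); apply: h => //.
  by rewrite e.
- move=> k w [Lw pw]; have [iw wi] := iP _ Lw.
  have [_ _ /(_ ((q (i w)).1 w) w (And3 iw wi erefl))] := qP (i w).
  suff <- : [set z | L z /\ p z = k] =
    [set z | [/\ lo (i w) <= z, z < u (i w) & (q (i w)).1 z = (q (i w)).1 w]] by [].
  apply/seteqP; split=> [z [Lz pz]|z [wz zw qz]] /=.
    have e : i z = i w by apply: peq => //; rewrite pz.
    have [iz zi] := iP _ Lz; rewrite -e; split=> //.
    by move: pz; rewrite -pw /p -e => /addnI; rewrite e.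
  by have [Lz iz] := iE _ _ wz zw; split=> //; rewrite -pw /p iz qz.
- move=> k; have [[w [Lw pw]]|nw] := pselect (exists w, L w /\ p w = k).
    exists (i w) => z Lz pz; have <- : i z = i w by apply: peq => //; rewrite pz.
    by have [] := iP _ Lz.
  by exists 0%N => z Lz pz; case: nw; exists z.
Qed.

Context (countT : countable [set: a]) (ge_omega : ordinal_le nat a).

(** [ge_omega] makes the first block infinite: moving each [f n] to [f n.+1] and fixing all other
    points embeds everything into the tail at [f 1], so [f 0] and [f 1] share a block, and a block
    with two points has no last one. *)
Lemma leading_block : exists x, [/\ forall z : a, x <= z, initial (cl setT x) &
  forall y, cl setT x y -> exists2 z, cl setT x z & y < z].
Proof.
have [f fm frange] := ge_omega.
have flt m n : (f m < f n) = (m < n)%N := fm m n.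
have finj : injective f.
  by move=> m n e; case: (ltngtP m n) => //; rewrite -flt e ltxx.
have f0 z : f 0%N <= z.
  rewrite leNgt; apply/negP => /[dup] zf /frange[n _ nz].
  by move: zf; rewrite -nz flt.
have L0 : cl setT (f 0%N) (f 0%N) by exact: cl_self.
have Li : initial (cl setT (f 0%N)).
  by move=> x y xy yx; apply: cl_convex L0 xy _ yx => // ? ?.
have L1 : cl setT (f 0%N) (f 1%N).
  split=> //; first by apply: emb_sub; exact: tl_sub.
  have /choice[s sP] z : exists y, (forall n, z = f n -> y = f n.+1) /\
      ((~ exists n, z = f n) -> y = z).
    have [[n ->]|nz] := pselect (exists n, z = f n); last first.
      by exists z; split=> // n zn; case: nz; exists n.
    exists (f n.+1); split=> [m|[]]; last by exists n.
    by move=> /finj->.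
  have out z n : ~ (exists n, z = f n) -> f n < z.
    move=> nz; rewrite ltNge; apply/negP; rewrite le_eqVlt => /orP[/eqP e|].
      by apply: nz; exists n.
    by move=> /frange[k _ kz]; apply: nz; exists k.
  have sf n : s (f n) = f n.+1 by have [+ _] := sP (f n); apply.
  have sN z : ~ (exists n, z = f n) -> s z = z by have [_] := sP z.
  exists s => [z w _ _|z _].
    have [[n ->]|nz] := pselect (exists n, z = f n);
      have [[m ->]|nw] := pselect (exists m, w = f m).
    - by rewrite !sf !flt.
    - by move=> _; rewrite sf (sN w) //; exact: out.
    - by move=> zf; have := lt_trans zf (out z m nz); rewrite ltxx.
    - by rewrite !sN.
  split=> //; have [[n ->]|nz] := pselect (exists n, z = f n).
    by rewrite sf leNgt flt.
  by rewrite sN //; exact/ltW/out.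
exists (f 0%N); split=> // y Ly; apply: contrapT => nmax.
have ymax z : cl setT (f 0%N) z -> z <= y.
  by move=> Lz; rewrite leNgt; apply/negP => yz; apply: nmax; exists z.
have e0 := cl_max wo Ly ymax L0; have e1 := cl_max wo Ly ymax L1.
have : f 0%N < f 1%N by rewrite flt.
by rewrite e0 e1 ltxx.
Qed.

(** [pr] records the intervals met by a copy, and [res] deletes the points of the first block
    outside the intervals in [Y]. A set is a copy as soon as it hosts each [S i] arbitrarily far
    out. A copy hosts all of [S 0, ..., S i] in its part of the interval [ms i], and this survives
    the restriction to any infinite set almost contained in the range of [ms]. *)
Lemma ordinal_projection : exists (pr : set a -> set nat)
    (res : set a -> set nat -> set a),
  [/\ forall A B, A `<=` B -> pr A `<=` pr B,
      forall A, emb setT A -> infinite_set (pr A),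
      forall A Y, res A Y `<=` A /\ pr (res A Y) `<=` Y &
      forall A, emb setT A -> exists X, infinite_set X /\
        forall Y, infinite_set Y -> finite_set (Y `\` X) -> emb setT (res A Y)].
Proof.
have [x0 [x0min Li Lnmax]] := leading_block.
set L := cl setT x0 in Li Lnmax; have L0 : L x0 by exact: cl_self.
have [||u [Lu uS ucof]] := @cofinal_sequence _ _ L (countable_sub countT L).
- by exists x0.
- exact: Lnmax.
have [p [pmon pti pbnd]] := block_index x0min Li Lu uS ucof.
pose S i := [set z | L z /\ p z = i].
have plt z w : L z -> (p z < p w)%N -> z < w.
  by move=> Lz; apply: contraTT; rewrite -leNgt -leqNgt; exact: pmon.
have Lf f z : incr_on setT f -> L z -> L (f z) by move=> fi; exact: cl_preserved.
have fge f (z : a) : incr_on setT f -> z <= f z.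
  by move=> fi; exact: (@incr_on_ge _ _ wo setT).
have unb k : exists2 b, L b & forall z, L z -> b <= z -> (k <= p z)%N.
  suff [n nP] : exists n, forall z, L z -> (p z < k)%N -> z < u n.
    exists (u n) => // z Lz; apply: contraTT; rewrite -ltnNge -ltNge; exact: nP.
  elim: k => [|k [n IH]]; first by exists 0%N.
  have [m mP] := pbnd k; exists (maxn n m) => z Lz.
  rewrite ltnS leq_eqVlt => /orP[/eqP/(mP _ Lz)|/(IH _ Lz)] /lt_le_trans; apply.
    by apply: increasing_seq_le => //; exact: leq_maxr.
  by apply: increasing_seq_le => //; exact: leq_maxl.
(* Only finitely many blocks meet the image of [S i], and the last of these
   contains the image of a tail of [S i]. *)
have piece A i k : emb setT A -> exists2 m, (k <= m)%N & emb (S i) (A `&` S m).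
  move=> [f fi fA]; have [[z1 [Lz1 pz1]]|nS] := pselect (exists z, S i z); last first.
    by exists k => //; exists id => // z Sz; case: nS; exists z.
  have [b Lb bk] := unb k.
  have [g gi gt] : emb L (tl L b) := cl_tail wo (fun _ _ _ _ => I) Lb.
  have [n nP] := pbnd i.
  have LF z : L z -> L (f (g z)) by move=> /gt[Lgz _]; exact: Lf.
  pose M m := `[< exists2 z, S i z & p (f (g z)) = m >].
  have [m /asboolP[z [Lz pz] <-] mmax] : exists2 m, M m & forall m', M m' -> (m' <= m)%N.
    have exM : exists m, M m by exists (p (f (g z1))); apply/asboolP; exists z1.
    have bM m : M m -> (m <= p (f (g (u n))))%N.
      move=> /asboolP[z [Lz pz] <-]; apply: pmon; first exact: LF.
      by apply/ltW/fi => //; apply: gi => //; exact: nP pz.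
    by exists (ex_maxn exM bM); case: ex_maxnP.
  exists (p (f (g z))).
    have [Lgz bgz] := gt _ Lz; apply: bk; first exact: LF.
    exact: le_trans bgz (fge _ _ fi).
  apply: emb_trans (pti i z (conj Lz pz)) _.
  exists (f \o g) => [v w [[Lv _] _] [[Lw _] _] vw|w [[Lw pw] zw]] /=.
    by apply: fi => //; exact: gi.
  split; first exact: fA.
  split; first exact: LF.
  apply/eqP; rewrite eqn_leq mmax /=; last by apply/asboolP; exists w.
  by apply: pmon; [exact: LF|apply: incr_on_le fi _ _ (incr_on_le gi _ _ zw)].
have largest j : exists i, forall i', (i' <= j)%N -> emb (S i') (S i).
  elim: j => [|j [i IH]].
    by exists 0%N => i'; rewrite leqn0 => /eqP->; exact: emb_refl.
  have [iS|Si] := emb_total wo (S i) (S j.+1).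
    exists j.+1 => i'; rewrite leq_eqVlt => /orP[/eqP->|/IH i'i].
      exact: emb_refl.
    exact: emb_trans i'i iS.
  by exists i => i'; rewrite leq_eqVlt => /orP[/eqP->//|/IH].
have pieces A j k : emb setT A ->
    exists2 m, (k <= m)%N & forall i, (i <= j)%N -> emb (S i) (A `&` S m).
  move=> TA; have [i iP] := largest j; have [m km im] := piece A i k TA.
  by exists m => // i' /iP i'i; exact: emb_trans i'i im.
have assemble A Y : emb setT A ->
    (forall i k, exists m, [/\ (k <= m)%N, Y m & emb (S i) (A `&` S m)]) ->
    emb setT [set z | A z /\ (L z -> Y (p z))].
  move=> [f fi fA] /= YP; have /choice[y yP] (ik : nat * nat) : exists m,
    [/\ (ik.2 <= m)%N, Y m & emb (S ik.1) (A `&` S m)] by exact: YP.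
  pose fix ms i := if i is j.+1 then y (i, (ms j).+1) else y (0%N, 0%N).
  have msP i : Y (ms i) /\ emb (S i) (A `&` S (ms i)).
    by case: i => [|i]; [have [] := yP (0%N, 0%N)|have [] := yP (i.+1, (ms i).+1)].
  have msS i : (ms i < ms i.+1)%N by have [] := yP (i.+1, (ms i).+1).
  have mslt i j : (i < j)%N -> (ms i < ms j)%N.
    by apply: (@homo_ltn _ ms (fun m n => (m < n)%N)) => // ? ? ?; exact: ltn_trans.
  have /choice[h hP] i : exists h, incr_on (S i) h /\
      forall z, S i z -> (A `&` S (ms i)) (h z).
    by have [_ [h]] := msP i; exists h.
  have hE z : L z -> [/\ A (h (p z) z), L (h (p z) z) & p (h (p z) z) = ms (p z)].
    by move=> Lz; have [_ /(_ z (conj Lz erefl))[? []]] := hP (p z).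
  (* Outside [L] the embedding [f] is kept: it moves points up and [L] is initial, so it never
     enters [L]. *)
  pose H z := if `[< L z >] then h (p z) z else f z.
  have HL z : L z -> H z = h (p z) z by rewrite /H => /asboolP->.
  have HN z : ~ L z -> H z = f z by rewrite /H => /asboolPn/negPf->.
  have fN z : ~ L z -> ~ L (f z).
    by move=> nLz Lfz; apply: nLz; apply: Li Lfz _; exact: fge.
  exists H => [z w _ _ zw|z _].
    have [Lw|nLw] := pselect (L w).
      have Lz := Li _ _ Lw (ltW zw); rewrite !HL //.
      have := pmon z w Lw (ltW zw); rewrite leq_eqVlt => /orP[/eqP e|].
        by rewrite -e; have [+ _] := hP (p z); apply.
      have [_ Lhz ez] := hE _ Lz; have [_ _ ew] := hE _ Lw.
      by move=> /mslt; rewrite -ez -ew; exact: plt.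
    rewrite (HN w) //; have [Lz|nLz] := pselect (L z); last by rewrite HN //; exact: fi.
    rewrite HL // ltNge; apply/negP => fwh; apply: (fN w) => //.
    by apply: Li fwh; have [] := hE _ Lz.
  have [Lz|nLz] := pselect (L z).
    by rewrite HL //; have [Ah Lh e] := hE _ Lz; split=> // _; rewrite e; case: (msP (p z)).
  by rewrite HN //; split; [exact: fA|move=> /fN; case].
exists (fun A => p @` (A `&` L)), (fun A Y => [set z | A z /\ (L z -> Y (p z))]); split.
- by move=> A B AB _ [z [/AB Bz Lz] <-]; exists z.
- move=> A [f fi fA]; apply/infinite_natP => k; have [b Lb bk] := unb k.
  exists (p (f b)); last by exists (f b) => //; split; [exact: fA|exact: Lf].
  by apply: bk; [exact: Lf|exact: fge].
- by move=> A Y; split=> [z []//|_ [z [[Az Yz] Lz] <-]]; exact: Yz.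
- move=> A TA; have /choice[y yP] (jk : nat * nat) : exists m, (jk.2 <= m)%N /\
    forall i, (i <= jk.1)%N -> emb (S i) (A `&` S m).
    by have [m] := pieces A jk.1 jk.2 TA; exists m.
  pose fix ms i := if i is j.+1 then y (i, (ms j).+1) else y (0%N, 0%N).
  have msP i : forall i', (i' <= i)%N -> emb (S i') (A `&` S (ms i)).
    by case: i => [|i]; [have [] := yP (0%N, 0%N)|have [] := yP (i.+1, (ms i).+1)].
  have msS i : (ms i < ms i.+1)%N by have [] := yP (i.+1, (ms i).+1).
  have mslt i j : (i < j)%N -> (ms i < ms j)%N.
    by apply: (@homo_ltn _ ms (fun m n => (m < n)%N)) => // ? ? ?; exact: ltn_trans.
  have msge i : (i <= ms i)%N by elim: i => // i IH; exact: leq_ltn_trans IH (msS i).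
  exists (range ms); split.
    by apply/infinite_natP => k; exists (ms k) => //; exists k.
  move=> Y Yinf Yfin; apply: assemble => // i k.
  have YX : infinite_set (Y `&` range ms).
    move=> fYX; apply: Yinf.
    by rewrite -(setUIDK Y (range ms)) finite_setU.
  have /infinite_natP/(_ (maxn k (ms i)))[m kim [Ym [j _ jm]]] := YX.
  exists m; split=> //; first by apply: leq_trans kim; exact: leq_maxl.
  rewrite -jm; apply: msP; rewrite leqNgt; apply/negP => /mslt; rewrite jm.
  by rewrite ltnNge (leq_trans _ kim) // leq_maxr.
Qed.

End projection.

(** * Failure of distributivity *)

Section PomegaFin_representatives.
Implicit Types (x y : PomegaFin_pos) (A B X Y Z : set nat).

Lemma pos_class A : infinite_set A -> exists x, val x = \pi_(PomegaFin) A.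
Proof.
move=> Ainf; have pA : \pi_(PomegaFin) A != \pi_(PomegaFin) set0.
  by apply/eqP => /PomegaFin_eqP/fin_eqP[+ _]; rewrite setD0.
by exists (Sub (\pi_(PomegaFin) A) pA); rewrite SubK.
Qed.

Lemma pos_repr x : exists2 A, infinite_set A & val x = \pi_(PomegaFin) A.
Proof.
exists (repr (val x)); last by rewrite reprK.
move=> fA; have := valP x; rewrite -[X in X != _]reprK => /eqP; apply.
by apply/PomegaFin_eqP/fin_eqP; rewrite setD0 set0D.
Qed.

Lemma pos_le x y A B : val x = \pi_(PomegaFin) A -> val y = \pi_(PomegaFin) B ->
  (x <= y) <-> finite_set (A `\` B).
Proof.
move=> xA yB; rewrite -PomegaFin_le_pi -xA -yB; split; first by [].
by [].
Qed.

End PomegaFin_representatives.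

Lemma infinite_diff (A B : set nat) : infinite_set A -> finite_set (A `\` B) ->
  infinite_set (A `&` B).
Proof.
by move=> Ainf fAB fI; apply: Ainf; rewrite -(setUIDK A B) finite_setU.
Qed.

(* Below a condition [A0] witnessing the failure of distributivity, the forcing
   looks like the whole of it, through an injection of [nat] into [A0]. *)
Lemma nowhere_distributive (W : Type) (F : set (set PomegaFin_pos)) :
  non_distributive F -> F #= [set: W] ->
  exists D : W -> set (set nat),
  [/\ forall x X Y, infinite_set X -> finite_set (X `\` Y) -> D x Y -> D x X,
      forall x X, infinite_set X ->
        exists Y, [/\ D x Y, infinite_set Y & finite_set (Y `\` X)] &
      forall X, infinite_set X -> exists x, ~ D x X].
Proof.
move=> [FD nF]; rewrite card_eq_le => /andP[/pfcard_geP[F0|[f]] _].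
  by case: nF => p; exists p => //; rewrite F0.
have [p0 p0P] : exists p0, forall q, q <= p0 -> exists2 E, F E & ~ E q.
  apply: contrapT => np; apply: nF => p; apply: contrapT => nq; apply: np.
  exists p => q qp; apply: contrapT => nE; apply: nq; exists q => // E FE.
  by apply: contrapT => nEq; apply: nE; exists E.
have [A0 A0inf p0A] := pos_repr p0.
have /infiniteP/pcard_leP[g] := A0inf.
have gA n : A0 (g n) by exact: funS.
have ginj : injective g by move=> m n; apply: inj; rewrite inE.
have gfin X : finite_set (g @` X) -> finite_set X.
  move=> fgX; apply: sub_finite_set (finite_preimage _ fgX).
    by move=> n Xn; exists n.
  by move=> m n _ _ /ginj.
have ginf X : infinite_set X -> infinite_set (g @` X) by move=> Xi /gfin.
have Ff x : F (f x) by exact: funS.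
exists (fun x => [set X | exists2 q, val q = \pi_(PomegaFin) (g @` X) & f x q]); split.
- move=> x X Y Xinf fXY [q qY fq]; have [r rX] := pos_class (ginf _ Xinf).
  exists r => //; have [fop _] := FD _ (Ff x); apply: fop fq.
  apply/(pos_le rX qY); apply: sub_finite_set (finite_image g fXY).
  by move=> _ [[n Xn <-] nY]; exists n => //; split=> // Yn; apply: nY; exists n.
- move=> x X Xinf; have [r rX] := pos_class (ginf _ Xinf).
  have [fop fde] := FD _ (Ff x); have [q qr fq] := fde r.
  have [Z Zinf qZ] := pos_repr q; have /(pos_le qZ rX) fZ := qr.
  have Yinf : infinite_set (g @^-1` Z).
    move=> /(finite_image g) fY; apply: (infinite_diff Zinf fZ).
    by apply: sub_finite_set fY => y [Zy [n Xn en]]; exists n => //=; rewrite en.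
  exists (g @^-1` Z); split=> //.
    have [s sY] := pos_class (ginf _ Yinf); exists s => //; apply: fop fq.
    apply/(pos_le sY qZ); suff -> : g @` (g @^-1` Z) `\` Z = set0 by [].
    by apply/seteqP; split=> // _ [[n Zn <-]].
  apply: gfin; apply: sub_finite_set fZ => _ [n [Zn nX] <-]; split=> //.
  by move=> [m Xm /ginj e]; apply: nX; rewrite -e.
- move=> X Xinf; have [r rX] := pos_class (ginf _ Xinf).
  have [|E FE nE] := p0P r.
    apply/(pos_le rX p0A); suff -> : g @` X `\` A0 = set0 by [].
    by apply/seteqP; split=> // _ [[n _ <-]].
  have [x _ fx] := @surj _ _ _ _ f E FE; exists x => -[q qX fq]; apply: nE.
  by rewrite -fx; suff <- : q = r by []; apply: val_inj; rewrite qX rX.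
Qed.

(** * The base tree for copies of a countable ordinal *)

Section copies.
Context {dW : Order.disp_t} {W : orderType dW} (homega1 : is_omega1 W).
Context (Dn : W -> set (set nat)).
Context (Dn_open : forall x X Y, infinite_set X -> finite_set (X `\` Y) ->
  Dn x Y -> Dn x X).
Context (Dn_dense : forall x X, infinite_set X ->
  exists Y, [/\ Dn x Y, infinite_set Y & finite_set (Y `\` X)]).
Context (Dn_empty : forall X, infinite_set X -> exists x, ~ Dn x X).
Context {d : Order.disp_t} {a : orderType d}.
Context (wo : well_order (<=%O : rel a)) (countT : countable [set: a]).

Lemma copies_le (A B : copies a) : (A <= B) <-> (val A `<=` val B).
Proof. by rewrite -[A <= B]/(val A <= val B) -subsetEset. Qed.

Lemma copyP (A : set a) : emb setT A -> exists B : copies a, val B = A.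
Proof.
move=> /(is_copyP wo)/asboolP cA; by exists (exist _ A cA).
Qed.

Lemma copy_emb (A : copies a) : emb setT (val A).
Proof. by apply/(is_copyP wo)/asboolP; exact: valP A. Qed.

(** The sequence descends only in the separative order, so its terms need not be nested. [inter]
    provides an actual common subcopy of each finite part, and the embeddings into these subcopies
    are diagonalised. *)
Lemma copies_sigma_closed (u : nat -> copies a) :
  (forall n, sep_le (u n.+1) (u n)) -> exists q, forall n, sep_le q (u n).
Proof.
move=> udec; have use m n : (m <= n)%N -> sep_le (u n) (u m).
  elim: n => [|n IH]; first by rewrite leqn0 => /eqP->; exact: sep_le_refl.
  rewrite leq_eqVlt => /orP[/eqP->|/IH nm]; first exact: sep_le_refl.
  exact: sep_le_trans (udec n) nm.
have inter n : exists C : copies a, forall i, (i <= n)%N -> C <= u i.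
  suff /(_ n (leqnn n))[C [_ CP]] : forall m, (m <= n)%N ->
      exists C : copies a, C <= u n /\ forall i, (i <= m)%N -> C <= u i by exists C.
  elim=> [|m IH] mn.
    have [C Cn C0] := use _ _ (leq0n n) (u n) (lexx _).
    by exists C; split=> // i; rewrite leqn0 => /eqP->.
  have [C [Cn CP]] := IH (ltnW mn); have [C' C'C C'm] := use _ _ mn C Cn.
  exists C'; split; first exact: le_trans Cn.
  move=> i; rewrite leq_eqVlt => /orP[/eqP->//|im].
  exact: le_trans C'C (CP _ im).
have /choice[f fP] n : exists f : a -> a, incr_on setT f /\
    forall i x, (i <= n)%N -> val (u i) (f x).
  have [C CP] := inter n; have [f fi fC] := copy_emb C; exists f; split=> // i x.
  by move=> /CP/copies_le; apply; exact: fC.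
have [B [/copyP[q qB] BP]] := pseudo_intersection wo countT (fun n => (fP n).1).
exists q => n r /copies_le rq.
have [|s sE] := copyP (BP n (val r) _ (copy_emb r)); first by rewrite -qB.
exists s; apply/copies_le; rewrite sE => y [] // _ [m nm [x _ <-]].
by have [_] := fP m; apply.
Qed.

Lemma copies_tree_embedding : ordinal_le nat a ->
  exists e : (W -> nat -> bool) * W -> copies a, dense_embedding (@node_le dW W) sep_le e.
Proof.
move=> ge_omega.
have [pr [res [prmon prinf resP thin]]] := ordinal_projection wo countT ge_omega.
have [p0 _] : exists p0 : copies a, val p0 = setT by apply: copyP; exact: emb_refl.
have /countable_injP[c cinj] := countT.
pose code (A : copies a) n := `[< exists2 z, val A z & c z = n >].
have code_inj : injective code.
  move=> A B AB; apply: val_inj; apply/seteqP.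
  have half (A' B' : copies a) : code A' = code B' -> val A' `<=` val B'.
    move=> /(congr1 (fun k => k _)) e z Az; move: (e (c z)).
    have -> : code A' (c z) by apply/asboolP; exists z.
    by move=> /esym/asboolP[w Bw /cinj <-]; rewrite ?inE.
  by split; apply: half.
pose D x : set (copies a) := [set A | exists2 B : copies a, sep_le A B & Dn x (pr (val B))].
have inf_nonempty X : infinite_set X -> exists n : nat, X n.
  by move=> /infinite_setN0.
have [|||e [emon ecomp edense]] := @tree_embedding (copies a) sep_le
  (@sep_le_refl _ _) (@sep_le_trans _ _) (@sep_le_sep _ _) p0 copies_sigma_closed
  _ W homega1 code code_inj D.
- by move=> x p q qp [B pB DB]; exists B => //; exact: sep_le_trans qp pB.
- move=> x A; have [X [Xinf XP]] := thin _ (copy_emb A).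
  have [Y [DY Yinf YX]] := Dn_dense x Xinf.
  have [B BE] := copyP (XP _ Yinf YX); have [resA resY] := resP (val A) Y.
  exists B; first by apply: sep_leW; apply/copies_le; rewrite BE.
  exists B; first exact: sep_le_refl.
  apply: Dn_open DY; first exact/prinf/copy_emb.
  rewrite BE; suff -> : pr (res (val A) Y) `\` Y = set0 by [].
  by apply/seteqP; split=> // n [/resY].
- move=> q; apply: contrapT => /forallNP nq.
  have {}nq x : D x q by apply: contrapT; exact: nq.
  have [X [Xinf XP]] := thin _ (copy_emb q).
  have [resA resX] := resP (val q) X.
  have [r rE] := copyP (XP X Xinf (eq_ind_r finite_set (finite_set0 _) (setDv X))).
  have rinf : infinite_set (pr (val r)) by exact/prinf/copy_emb.
  have [x nDx] := Dn_empty rinf; apply: nDx.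
  have [B qB DB] := nq x; apply: Dn_open DB => //.
  (* If [Z] were infinite, restricting [q] to [Z] would give a copy compatible with [B]; a common
     subcopy [v] would project to a nonempty set inside both [Z] and [pr (val B)], which are
     disjoint. *)
  set Z := _ `\` _; apply: contrapT => Zinf.
  have ZX : Z `<=` X by move=> n [+ _]; rewrite rE; exact: resX.
  have [|s sE] := copyP (XP Z Zinf _).
    suff -> : Z `\` X = set0 by [].
    by apply/seteqP; split=> // n [/ZX].
  have [resA' resZ] := resP (val q) Z.
  have [|v vs vB] := qB s; first by apply/copies_le; rewrite sE.
  have [n vn] := inf_nonempty _ (prinf _ (copy_emb v)).
  have [] : Z n by apply: resZ; rewrite -sE; apply: prmon vn; exact/copies_le.
  by move=> _; apply; apply: prmon vn; exact/copies_le.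
by exists e; split.
Qed.

End copies.

(** * Copies of nat and the comparison with P(omega)/Fin *)

Lemma nat_well_order : well_order (<=%O : rel nat).
Proof.
apply: antisymmetric_well_order => [m n|A [n An]]; first by move/le_anti.
by exists (ex_minn (ex_intro _ n An)); case: ex_minnP => m Am mmin; split.
Qed.

Lemma copies_nat (A : set nat) : emb setT A <-> infinite_set A.
Proof.
split=> [[f fi fA]|/infinite_natP Ainf].
  apply/infinite_natP => k; exists (f k); last exact: fA.
  exact: (@incr_on_ge _ _ nat_well_order setT).
have /choice[y yP] k : exists m, (k <= m)%N /\ A m by have [m] := Ainf k; exists m.
pose fix f n := if n is m.+1 then y (f m).+1 else y 0%N.
exists f => [m n _ _|[|n] _]; [|exact: (yP _).2|exact: (yP _).2].
apply: (@homo_ltn _ f (fun m n => (m < n)%N)) => [? ? ?|i]; first exact: ltn_trans.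
exact: (yP (f i).+1).1.
Qed.

Theorem theorem5p4 (dW : Order.disp_t) (omega1 : orderType dW)
    (homega1 : is_omega1 omega1)
    (hh : distributivity_number_is omega1)
    (d : Order.disp_t) (alpha : orderType d)
    (halpha : well_order (<=%O : rel alpha))
    (halpha_countable : countable [set: alpha])
    (halpha_omega : ordinal_le nat alpha) :
  forcing_equivalent (copies alpha) PomegaFin_pos.
Proof.
have [[F nF Fomega1] _] := hh.
have [D [Dop Dde Dem]] := nowhere_distributive nF Fomega1.
have [e eP] :=
  copies_tree_embedding homega1 Dop Dde Dem halpha halpha_countable halpha_omega.
have nn : ordinal_le nat nat.
  by exists id => [//|x y _]; exists y.
have [e' [emon ecomp edense]] :=
  copies_tree_embedding homega1 Dop Dde Dem nat_well_order (countableP _) nn.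
have infc (A : copies nat) : infinite_set (val A).
  exact/copies_nat/(copy_emb nat_well_order).
(* On copies of [nat] the separative order implies almost inclusion: an infinite difference would be
   a copy below [A] incompatible with [B]. *)
have sepP (A B : copies nat) : sep_le A B -> finite_set (val A `\` val B).
  move=> AB; apply: contrapT => /copies_nat/(copyP nat_well_order)[C CE].
  have [|s sC sB] := AB C; first by apply/copies_le; rewrite CE => n [].
  have [n sn] := infinite_setN0 (infc s).
  have := (copies_le _ _).1 sC _ sn; rewrite CE => -[_]; apply.
  exact: (copies_le _ _).1 sB _ sn.
(* Taking classes carries the tree from copies of [nat] to P(omega)/Fin: compatible classes have
   representatives with infinite intersection, which is itself a copy. *)
have /choice[k kP] t : exists x : PomegaFin_pos, val x = \pi_(PomegaFin) (val (e' t)).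
  exact/pos_class/infc.
apply: (forcing_equivalent_embedding (e' := k) eP); split=> [t' t t't|t t'|q].
- by apply: sep_leW; apply/(pos_le (kP t') (kP t))/sepP/emon.
- move=> /sep_compat[r rt rt']; apply: ecomp.
  have [Z Zinf rZ] := pos_repr r.
  have /(pos_le rZ (kP t)) Zt := rt; have /(pos_le rZ (kP t')) Zt' := rt'.
  have /copies_nat/(copyP nat_well_order)[C CE] :
      infinite_set (val (e' t) `&` val (e' t')).
    have Zti := infinite_diff Zinf Zt.
    have : infinite_set (Z `&` val (e' t) `&` val (e' t')).
      by apply: infinite_diff Zti _; apply: sub_finite_set Zt' => n [[]].
    by apply: sub_infinite_set => n [[_ ?] ?].
  by exists C; apply: sep_leW; apply/copies_le; rewrite CE => n [].
- have [Z Zinf qZ] := pos_repr q.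
  have /copies_nat/(copyP nat_well_order)[C CE] := Zinf.
  have [t tC] := edense C; exists t; apply: sep_leW; apply/(pos_le (kP t) qZ).
  by rewrite -CE; exact: sepP.
Qed.
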